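(* (1) Let $R$ be any associative (not necessarily commutative) ring with identity and let $n\ge 1$. Then $M_n(R)$ is a separable Frobenius extension of $S_n(R)$. Moreover, $S_n(R)$ is Morita equivalent to $S_2(R)$ if $n$ is even, and $S_n(R)$ is Morita equivalent to $S_3(R)$ if $n\ge 3$ is odd. (2) If $R$ is a commutative ring, then $S_n(R)$ is a cellular $R$-algebra for every $n\ge 1$.
   Context: For a ring $R$ with identity and $n\ge 1$, $M_n(R)$ is the ring of $n\times n$ matrices over $R$, and $$S_n(R):=\{a=(a_{ij})\in M_n(R)\mid a_{ij}=a_{n+1-i,\,n+1-j}\text{ for all }1\le i,j\le n\}$$ is the subring of centrosymmetric matrices (with the same identity as $M_n(R)$). Two rings are Morita equivalent if their categories of all left modules are equivalent. Let $B\subseteq A$ be an extension of rings (i.e. $B$ is a subring of $A$ with the same identity). It is a Frobenius extension if ${}_BA$ is a finitely generated projective left $B$-module and $\mathrm{Hom}_B({}_BA,{}_BB)\simeq {}_AA_B$ as $A$-$B$-bimodules (where $(a\cdot f\cdot b)(x)=f(xa)b$). It is separable if the multiplication map $A\otimes_BA\to A$ is a split surjective homomorphism of $A$-$A$-bimodules. A separable Frobenius extension is one that is both. Let $R$ be a commutative ring and $A$ an $R$-algebra. An $R$-involution on $A$ is an $R$-linear anti-automorphism $i$ of $A$ with $i^2=\mathrm{id}$. A two-sided ideal $J$ of $A$ is a cell ideal (with respect to $i$) if $i(J)=J$ and there exist a left ideal $\Delta\subseteq J$ of $A$ that is finitely generated and free over $R$, and an isomorphism of $A$-$A$-bimodules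 $\alpha: J\to \Delta\otimes_R i(\Delta)$, such that $\alpha\circ i=\tau\circ\alpha$, where $\tau(x\otimes y)=i(y)\otimes i(x)$. The algebra $A$ with the involution $i$ is cellular if there is an $R$-module decomposition $A=J'_1\oplus\cdots\oplus J'_k$ with $i(J'_j)=J'_j$ for all $j$ such that each $J_j:=\bigoplus_{p=1}^{j}J'_p$ is a two-sided ideal of $A$ and, for each $j$, the quotient $J_j/J_{j-1}$ (with $J_0=0$) is a cell ideal of $A/J_{j-1}$ with respect to the involution induced by $i$. An $R$-algebra is called cellular if it is cellular with respect to some $R$-involution. *)

(* Defs.v *)
From HB Require Import structures.
From mathcomp Require Import all_boot all_order all_algebra.
From mathcomp Require Import boolp.
From mathcomp.multinomials Require Import freeg.

Set Implicit Arguments.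
Unset Strict Implicit.
Unset Printing Implicit Defensive.

Import GRing.Theory.
Local Open Scope ring_scope.
Local Open Scope quotient_scope.

(* Rings are [pzRingType]s: associative with identity, and possibly zero, since
   neither the base ring nor a quotient ring below is assumed nontrivial. *)

(* Linear maps are compared pointwise (equivalent to [=] under functional
   extensionality). *)
Record modFunctor (A B : pzRingType) := ModFunctor {
  fobj : lmodType A -> lmodType B;
  fmap : forall M N : lmodType A, {linear M -> N} -> {linear fobj M -> fobj N};
  fmap_ext : forall (M N : lmodType A) (f g : {linear M -> N}),
    f =1 g -> fmap f =1 fmap g;
  fmap_id : forall M : lmodType A, fmap (idfun : {linear M -> M}) =1 idfun;
  fmap_comp : forall (M N P : lmodType A)
      (g : {linear N -> P}) (f : {linear M -> N}),
    fmap (g \o f : {linear M -> P}) =1 fmap g \o fmap f }.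

Definition Morita_equivalent (A B : pzRingType) : Prop :=
  exists (F : modFunctor A B) (G : modFunctor B A)
         (eta : forall M : lmodType A, {linear M -> fobj G (fobj F M)})
         (eps : forall N : lmodType B, {linear fobj F (fobj G N) -> N}),
  [/\ forall M, bijective (eta M),
      forall (M M' : lmodType A) (f : {linear M -> M'}),
        eta M' \o f =1 fmap G (fmap F f) \o eta M,
      forall N, bijective (eps N)
    & forall (N N' : lmodType B) (g : {linear N -> N'}),
        eps N' \o fmap F (fmap G g) =1 g \o eps N].

Section Tensor.
(* [M] is a right module via [ra], [N] a left module via [la], over scalars
   [B]; [tensor ra la] is the quotient of the free abelian group on [M * N] by
   the subgroup generated by the usual relations. *)
Variables (B : Type) (M N : zmodType) (ra : M -> B -> M) (la : B -> N -> N).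

Let F : zmodType := {freeg (M * N)%type / int}.
Let gen (x : M) (y : N) : F := << (x, y) >>.

Definition tensor_rels (S : F -> Prop) : Prop :=
  [/\ forall x x' y, S (gen (x + x') y - gen x y - gen x' y),
      forall x y y', S (gen x (y + y') - gen x y - gen x y')
    & forall x b y, S (gen (ra x b) y - gen x (la b y))].

Definition tensor_ker : {pred F} := fun d =>
  `[< forall S : {pred F}, zmod_closed S -> tensor_rels (fun e => e \in S) ->
      d \in S >].

Fact tensor_ker_zmod_closed : zmod_closed tensor_ker.
Proof.
split=> [|d e /asboolP Sd /asboolP Se]; apply/asboolP => S zS rS.
  exact: zS.1.
exact/zS.2/Se/rS/zS/Sd.
Qed.

HB.instance Definition _ :=
  GRing.isZmodClosed.Build F tensor_ker tensor_ker_zmod_closed.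

Definition tensor : Type := Quotient.quot tensor_ker.

HB.instance Definition _ := GRing.Zmodule.on tensor.

Definition tens (x : M) (y : N) : tensor :=
  \pi_(Quotient.quot tensor_ker) (gen x y).

Fact tensor_ker_rels : tensor_rels (fun d => d \in tensor_ker).
Proof.
split=> *; apply/asboolP => S _ [h1 h2 h3];
  [exact: h1 | exact: h2 | exact: h3].
Qed.

Definition balanced (G : zmodType) (h : M -> N -> G) : Prop :=
  [/\ forall y, {morph h^~ y : x x' / x + x'},
      forall x, {morph h x : y y' / y + y'}
    & forall x b y, h (ra x b) y = h x (la b y)].

Fact tens_balanced : balanced tens.
Proof.
have kerE (d e : F) : d - e \in tensor_ker ->
    \pi_(Quotient.quot tensor_ker) d = \pi_(Quotient.quot tensor_ker) e.
  by rewrite Quotient.idealrBE => /eqP.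
have piD (d e : F) : \pi_(Quotient.quot tensor_ker) (d + e) =
    \pi_(Quotient.quot tensor_ker) d + \pi_(Quotient.quot tensor_ker) e.
  exact: raddfD.
case: tensor_ker_rels => hl hr hB; split=> [y x x'|x y y'|x b y].
- by rewrite -[RHS]piD; apply: kerE; rewrite opprD addrA; exact: hl.
- by rewrite -[RHS]piD; apply: kerE; rewrite opprD addrA; exact: hr.
- exact/kerE/hB.
Qed.

(* The additive map sending [x (x) y] to [h x y], computed on a representative;
   well defined when [h] is balanced (see [tens_lift_tens], [tens_liftB]). *)
Definition tens_lift (G : zmodType) (h : M -> N -> G) (t : tensor) : G :=
  fglift (fun p : M * N => h p.1 p.2 : zmodule G)
    (repr (t : Quotient.quot tensor_ker) : F).

Section Lift.
Variables (G : zmodType) (h : M -> N -> G).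
Hypothesis hb : balanced h.

Let fgl : F -> zmodule G := fglift (fun p : M * N => h p.1 p.2 : zmodule G).

Let fglB : {morph fgl : d e / d - e}. Proof. exact: lift_is_additive. Qed.

Let fgl_gen x y : fgl (gen x y) = h x y.
Proof. by rewrite /fgl liftU scale1r. Qed.

Let fgl_ker d : d \in tensor_ker -> fgl d = 0.
Proof.
move=> /asboolP dP; apply/eqP; case: (hb) => hl hr hB.
apply: (dP (fun e => fgl e == 0)).
  split=> [|a b]; rewrite !unfold_in.
    by rewrite -(subrr (0 : F)) fglB subrr.
  by move=> /eqP ha /eqP hb'; rewrite fglB ha hb' subrr.
split=> *; rewrite unfold_in !fglB !fgl_gen.
- by rewrite hl -addrA -opprD subrr.
- by rewrite hr -addrA -opprD subrr.
- by rewrite hB subrr.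
Qed.

Let tens_lift_pi d :
  tens_lift h (\pi_(Quotient.quot tensor_ker) d : tensor) = fgl d.
Proof.
rewrite /tens_lift -/fgl; apply/eqP; rewrite -subr_eq0 -fglB.
by apply/eqP/fgl_ker; rewrite Quotient.idealrBE reprK.
Qed.

Lemma tens_lift_tens x y : tens_lift h (tens x y) = h x y.
Proof. by rewrite tens_lift_pi fgl_gen. Qed.

Lemma tens_liftB : {morph tens_lift h : t u / t - u}.
Proof.
move=> t u.
have piB (d e : F) : \pi_(Quotient.quot tensor_ker) (d - e) =
    \pi_(Quotient.quot tensor_ker) d - \pi_(Quotient.quot tensor_ker) e.
  exact: raddfB.
have tE (v : tensor) : v = \pi_(Quotient.quot tensor_ker) (repr
    (v : Quotient.quot tensor_ker)) by rewrite reprK.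
by rewrite [t]tE [u]tE -[_ - _]piB !tens_lift_pi fglB.
Qed.

End Lift.

End Tensor.

Definition finitely_generated (B : pzRingType) (M : lmodType B) : Prop :=
  exists (m : nat) (e : 'I_m -> M),
    forall x, exists c : 'I_m -> B, x = \sum_i c i *: e i.

Definition projective (B : pzRingType) (P : lmodType B) : Prop :=
  forall (M N : lmodType B) (p : {linear M -> N}) (f : {linear P -> N}),
    (forall y, exists x, p x = y) ->
    exists g : {linear P -> M}, p \o g =1 f.

Section Subring.
Variables (A : pzRingType) (S : subringClosed A).

Definition subring : Type := {x : A | x \in S}.

HB.instance Definition _ := SubChoice.copy subring {x : A | x \in S}.
HB.instance Definition _ :=
  GRing.SubChoice_isSubPzRing.Build _ _ subring (subringClosedP _).

(* [A] as a left module over its subring. *)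
Definition ext_lmod : Type := A.

HB.instance Definition _ := GRing.Zmodule.on ext_lmod.

Let ext_scale (b : subring) (x : ext_lmod) : ext_lmod := val b * (x : A).

Fact ext_scaleA b c x : ext_scale b (ext_scale c x) = ext_scale (b * c) x.
Proof. exact: mulrA. Qed.
Fact ext_scale1 : left_id 1 ext_scale.
Proof. exact: mul1r. Qed.
Fact ext_scaleDr : right_distributive ext_scale +%R.
Proof. by move=> b x y; exact: mulrDr. Qed.
Fact ext_scaleDl x : {morph ext_scale^~ x : b c / b + c}.
Proof. by move=> b c; exact: mulrDl. Qed.

HB.instance Definition _ := GRing.Zmodule_isLmodule.Build subring ext_lmod
  ext_scaleA ext_scale1 ext_scaleDr ext_scaleDl.

Definition Frobenius_extension : Prop :=
  [/\ finitely_generated ext_lmod,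
      projective ext_lmod
    & exists theta : A -> {linear ext_lmod -> subring^o},
        [/\ forall y z x, theta (y + z) x = theta y x + theta z x,
            forall (a y : A) (b : subring) (x : A),
              theta (a * y * val b) x = theta y (x * a : A) * b
          & forall f : {linear ext_lmod -> subring^o}, exists! y, theta y =1 f]].

Definition tensAA : Type :=
  tensor (fun (x : A) (b : subring) => x * val b)
         (fun (b : subring) (y : A) => val b * y).

HB.instance Definition _ := GRing.Zmodule.on tensAA.

Definition tensAA_mul : tensAA -> A := tens_lift (fun x y : A => x * y).

Definition tensAA_act (a b : A) : tensAA -> tensAA :=
  tens_lift (fun x y : A => tens _ _ (a * x) (y * b) : tensAA).

Fact tensAA_mul_balanced :
  balanced (fun (x : A) (b : subring) => x * val b)
           (fun (b : subring) (y : A) => val b * y) (fun x y : A => x * y).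
Proof.
by split=> [y x x'|x y y'|x b y]; rewrite ?mulrDl ?mulrDr ?mulrA.
Qed.

Fact tensAA_act_balanced (a c : A) :
  balanced (fun (x : A) (b : subring) => x * val b)
           (fun (b : subring) (y : A) => val b * y)
           (fun x y : A => tens _ _ (a * x) (y * c) : tensAA).
Proof.
case: (tens_balanced (fun (x : A) (b : subring) => x * val b)
  (fun (b : subring) (y : A) => val b * y)) => hl hr hB.
by split=> [y x x'|x y y'|x b y]; rewrite ?mulrDr ?mulrDl ?mulrA ?hB -?mulrA
  ?hB ?mulrA ?hl ?hr.
Qed.

Definition separable_extension : Prop :=
  exists s : A -> tensAA,
    [/\ {morph s : x y / x + y},
        forall a x b : A, s (a * x * b) = tensAA_act a b (s x)
      & cancel s tensAA_mul].

Definition separable_Frobenius_extension : Prop :=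
  separable_extension /\ Frobenius_extension.

End Subring.

HB.mixin Record isLmulClosed (A : pzRingType) (S : A -> bool) := {
  idealMl_subproof : forall a x, x \in (S : {pred A}) ->
                       a * x \in (S : {pred A}) }.
HB.mixin Record isRmulClosed (A : pzRingType) (S : A -> bool) := {
  idealMr_subproof : forall a x, x \in (S : {pred A}) ->
                       x * a \in (S : {pred A}) }.

#[short(type="leftIdeal")]
HB.structure Definition LeftIdeal (A : pzRingType) :=
  {S of GRing.ZmodClosed A S & isLmulClosed A S}.
#[short(type="rightIdeal")]
HB.structure Definition RightIdeal (A : pzRingType) :=
  {S of GRing.ZmodClosed A S & isRmulClosed A S}.
#[short(type="ideal")]
HB.structure Definition Ideal (A : pzRingType) :=
  {S of LeftIdeal A S & RightIdeal A S}.

Lemma idealMl (A : pzRingType) (I : leftIdeal A) (a x : A) :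
  x \in I -> a * x \in I.
Proof. exact: idealMl_subproof. Qed.

Lemma idealMr (A : pzRingType) (I : rightIdeal A) (a x : A) :
  x \in I -> x * a \in I.
Proof. exact: idealMr_subproof. Qed.

Section SubZmod.
Variables (A : pzRingType) (I : zmodClosed A).

Definition sub_zmod : Type := {x : A | x \in I}.

HB.instance Definition _ := SubChoice.copy sub_zmod {x : A | x \in I}.
HB.instance Definition _ := [SubChoice_isSubZmodule of sub_zmod by <:].
End SubZmod.

Definition lact (A : pzRingType) (I : leftIdeal A) (a : A) (x : sub_zmod I) :
  sub_zmod I := Sub (a * val x) (idealMl a (valP x)).

Definition ract (A : pzRingType) (I : rightIdeal A) (x : sub_zmod I) (a : A) :
  sub_zmod I := Sub (val x * a) (idealMr a (valP x)).

Definition img (A B : choiceType) (f : A -> B) (S : {pred A}) : {pred B} :=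
  fun y => `[< exists2 x, x \in S & y = f x >].

Section QuotientRing.
Variables (A : pzRingType) (I : ideal A).

Definition quot_ring : Type := Quotient.quot I.

HB.instance Definition _ := GRing.Zmodule.on quot_ring.

Definition quot_pi (x : A) : quot_ring := \pi_(Quotient.quot I) x.
Definition quot_repr (u : quot_ring) : A := repr (u : Quotient.quot I).

Lemma quot_reprK : cancel quot_repr quot_pi.
Proof. exact: reprK. Qed.

Lemma quot_piP x y : quot_pi x = quot_pi y <-> x - y \in I.
Proof. by rewrite Quotient.idealrBE; split=> h; apply/eqP. Qed.

Fact quot_pi_is_additive : zmod_morphism quot_pi.
Proof. by move=> x y; exact: raddfB. Qed.

HB.instance Definition _ :=
  GRing.isZmodMorphism.Build A quot_ring quot_pi quot_pi_is_additive.

Let quot_mul (u v : quot_ring) : quot_ring :=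
  quot_pi (quot_repr u * quot_repr v).

Let quot_piM x y : quot_mul (quot_pi x) (quot_pi y) = quot_pi (x * y).
Proof.
set x' := quot_repr (quot_pi x); set y' := quot_repr (quot_pi y).
have hx : x' - x \in I by apply/quot_piP; rewrite quot_reprK.
have hy : y' - y \in I by apply/quot_piP; rewrite quot_reprK.
apply/quot_piP.
have -> : x' * y' - x * y = (x' - x) * y' + x * (y' - y).
  by rewrite mulrBl mulrBr addrA subrK.
by apply: rpredD; [apply: idealMr | apply: idealMl].
Qed.

Let quot_one : quot_ring := quot_pi 1.

Fact quot_mulA : associative quot_mul.
Proof.
move=> u v w; rewrite -[u]quot_reprK -[v]quot_reprK -[w]quot_reprK.
by rewrite !quot_piM mulrA.
Qed.

Fact quot_mul1l : left_id quot_one quot_mul.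
Proof. by move=> u; rewrite -[u]quot_reprK quot_piM mul1r. Qed.

Fact quot_mul1r : right_id quot_one quot_mul.
Proof. by move=> u; rewrite -[u]quot_reprK quot_piM mulr1. Qed.

Fact quot_mulDl : left_distributive quot_mul +%R.
Proof.
move=> u v w; rewrite -[u]quot_reprK -[v]quot_reprK -[w]quot_reprK.
by rewrite !quot_piM -!raddfD /= !quot_piM mulrDl.
Qed.

Fact quot_mulDr : right_distributive quot_mul +%R.
Proof.
move=> u v w; rewrite -[u]quot_reprK -[v]quot_reprK -[w]quot_reprK.
by rewrite !quot_piM -!raddfD /= !quot_piM mulrDr.
Qed.

HB.instance Definition _ := GRing.Zmodule_isPzRing.Build quot_ring
  quot_mulA quot_mul1l quot_mul1r quot_mulDl quot_mulDr.

Fact quot_pi_is_monoid : monoid_morphism quot_pi.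
Proof. by split=> // x y; rewrite -quot_piM. Qed.

HB.instance Definition _ :=
  GRing.isMonoidMorphism.Build A quot_ring quot_pi quot_pi_is_monoid.

(* The image [(I + J) / I] of [J] in [A / I]. *)
Definition quot_ideal (J : ideal A) : {pred quot_ring} := img quot_pi J.

Section QuotIdeal.
Variable J : ideal A.

Fact quot_ideal_zmod : zmod_closed (quot_ideal J).
Proof.
split=> [|_ _ /asboolP[x xJ ->] /asboolP[y yJ ->]]; apply/asboolP.
  by exists 0; rewrite ?rpred0 ?raddf0.
by exists (x - y); rewrite ?rpredB ?raddfB.
Qed.

Fact quot_ideal_lmul (u v : quot_ring) :
  v \in quot_ideal J -> u * v \in quot_ideal J.
Proof.
move=> /asboolP[x xJ ->]; apply/asboolP; exists (quot_repr u * x).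
  exact: idealMl.
by rewrite rmorphM /= quot_reprK.
Qed.

Fact quot_ideal_rmul (u v : quot_ring) :
  v \in quot_ideal J -> v * u \in quot_ideal J.
Proof.
move=> /asboolP[x xJ ->]; apply/asboolP; exists (x * quot_repr u).
  exact: idealMr.
by rewrite rmorphM /= quot_reprK.
Qed.

HB.instance Definition _ :=
  GRing.isZmodClosed.Build quot_ring (quot_ideal J) quot_ideal_zmod.
HB.instance Definition _ :=
  isLmulClosed.Build quot_ring (quot_ideal J) quot_ideal_lmul.
HB.instance Definition _ :=
  isRmulClosed.Build quot_ring (quot_ideal J) quot_ideal_rmul.
End QuotIdeal.
End QuotientRing.

Arguments quot_ideal {A} I J.

(* An algebra over a commutative ring is a ring with a central structure
   morphism; [r] acts as multiplication by [alg_str r].  ([algType] requires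
   the algebra to be a nonzero ring.) *)
Record algebra (R : comPzRingType) := Algebra {
  alg_ring :> pzRingType;
  alg_str : {rmorphism R -> alg_ring};
  alg_central : forall r x, alg_str r * x = x * alg_str r }.

Section Cellular.
Variable R : comPzRingType.
Implicit Types A : algebra R.

Record involution A := Involution {
  inv_fun :> A -> A;
  involutionD : {morph inv_fun : x y / x + y};
  involutionZ : forall r x, inv_fun (alg_str A r * x) = alg_str A r * inv_fun x;
  involutionM : forall x y, inv_fun (x * y) = inv_fun y * inv_fun x;
  involutionK : involutive inv_fun }.

Lemma involution0 A (i : involution A) : i 0 = 0.
Proof. by apply: (@addIr _ (i 0)); rewrite -involutionD !add0r. Qed.

Lemma involutionN A (i : involution A) x : i (- x) = - i x.
Proof.
by apply: (@addIr _ (i x)); rewrite -involutionD !addNr involution0.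
Qed.

Lemma involutionB A (i : involution A) x y : i (x - y) = i x - i y.
Proof. by rewrite involutionD involutionN. Qed.

Section InvImage.
Variables (A : algebra R) (i : involution A) (D : leftIdeal A).

Definition inv_img : {pred A} := img i D.

Fact inv_img_zmod : zmod_closed inv_img.
Proof.
split=> [|_ _ /asboolP[x xD ->] /asboolP[y yD ->]]; apply/asboolP.
  by exists 0; rewrite ?rpred0 ?involution0.
by exists (x - y); rewrite ?rpredB ?involutionB.
Qed.

Fact inv_img_rmul (a y : A) : y \in inv_img -> y * a \in inv_img.
Proof.
move=> /asboolP[x xD ->]; apply/asboolP; exists (i a * x).
  exact: idealMl.
by rewrite involutionM involutionK.
Qed.

HB.instance Definition _ := GRing.isZmodClosed.Build A inv_img inv_img_zmod.
HB.instance Definition _ := isRmulClosed.Build A inv_img inv_img_rmul.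

Fact inv_to_subproof (x : sub_zmod D) : i (val x) \in inv_img.
Proof. by apply/asboolP; exists (val x) => //; exact: valP. Qed.

Fact inv_from_subproof (y : sub_zmod inv_img) : i (val y) \in D.
Proof.
by case: y => y /= /asboolP[x xD ->]; rewrite involutionK.
Qed.

Definition inv_to (x : sub_zmod D) : sub_zmod inv_img :=
  Sub (i (val x)) (inv_to_subproof x).
Definition inv_from (y : sub_zmod inv_img) : sub_zmod D :=
  Sub (i (val y)) (inv_from_subproof y).

(* [D (x)_R i(D)], its bimodule structure and its flip
   [x (x) y |-> i(y) (x) i(x)]. *)
Definition cell_tens : Type :=
  tensor (fun (x : sub_zmod D) (r : R) => lact (alg_str A r) x)
         (fun (r : R) (y : sub_zmod inv_img) => ract y (alg_str A r)).

HB.instance Definition _ := GRing.Zmodule.on cell_tens.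

Definition cell_tens_act (a b : A) : cell_tens -> cell_tens :=
  tens_lift (fun (x : sub_zmod D) (y : sub_zmod inv_img) =>
    tens _ _ (lact a x) (ract y b) : cell_tens).

Definition cell_tens_flip : cell_tens -> cell_tens :=
  tens_lift (fun (x : sub_zmod D) (y : sub_zmod inv_img) =>
    tens _ _ (inv_from y) (inv_to x) : cell_tens).

Fact cell_tens_act_balanced (a b : A) :
  balanced (fun (x : sub_zmod D) (r : R) => lact (alg_str A r) x)
    (fun (r : R) (y : sub_zmod inv_img) => ract y (alg_str A r))
    (fun (x : sub_zmod D) (y : sub_zmod inv_img) =>
      tens _ _ (lact a x) (ract y b) : cell_tens).
Proof.
case: (tens_balanced (fun (x : sub_zmod D) (r : R) => lact (alg_str A r) x)
  (fun (r : R) (y : sub_zmod inv_img) => ract y (alg_str A r))) => hl hr hB.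
split=> [y x x'|x y y'|x r y].
- by rewrite -hl; congr (tens _ _ _ _); apply: val_inj; exact: mulrDr.
- by rewrite -hr; congr (tens _ _ _ _); apply: val_inj; exact: mulrDl.
- have -> : lact a (lact (alg_str A r) x) = lact (alg_str A r) (lact a x).
    by apply: val_inj; rewrite /= !mulrA alg_central.
  rewrite hB; congr (tens _ _ _ _); apply: val_inj.
  by rewrite /= -!mulrA alg_central.
Qed.

Fact cell_tens_flip_balanced :
  balanced (fun (x : sub_zmod D) (r : R) => lact (alg_str A r) x)
    (fun (r : R) (y : sub_zmod inv_img) => ract y (alg_str A r))
    (fun (x : sub_zmod D) (y : sub_zmod inv_img) =>
      tens _ _ (inv_from y) (inv_to x) : cell_tens).
Proof.
case: (tens_balanced (fun (x : sub_zmod D) (r : R) => lact (alg_str A r) x)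
  (fun (r : R) (y : sub_zmod inv_img) => ract y (alg_str A r))) => hl hr hB.
split=> [y x x'|x y y'|x r y].
- by rewrite -hr; congr (tens _ _ _ _); apply: val_inj; exact: involutionD.
- by rewrite -hl; congr (tens _ _ _ _); apply: val_inj; exact: involutionD.
- have -> : inv_to (lact (alg_str A r) x) = ract (inv_to x) (alg_str A r).
    by apply: val_inj; rewrite /= involutionZ alg_central.
  rewrite -hB; congr (tens _ _ _ _); apply: val_inj.
  by rewrite /= -alg_central involutionZ.
Qed.
End InvImage.

Definition finite_free A (D : leftIdeal A) : Prop :=
  exists (m : nat) (e : 'I_m -> sub_zmod D),
    forall x, exists! c : {ffun 'I_m -> R},
      x = \sum_j lact (alg_str A (c j)) (e j).

Definition stable A (i : involution A) (S : {pred A}) : Prop := img i S =i S.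

Definition cell_ideal A (i : involution A) (J : ideal A) : Prop :=
  stable i J /\
  exists D : leftIdeal A,
  [/\ {subset D <= J}, finite_free D
    & exists alpha : sub_zmod J -> cell_tens i D,
      [/\ bijective alpha,
          {morph alpha : x y / x + y},
          forall (a b : A) x, alpha (lact a (ract x b)) =
            cell_tens_act a b (alpha x)
        & forall x y : sub_zmod J, val y = i (val x) ->
            alpha y = cell_tens_flip (alpha x)]].

Section QuotientAlgebra.
Variables (A : algebra R) (I : ideal A).

Fact quot_alg_central r (u : quot_ring I) :
  (quot_pi I \o alg_str A) r * u = u * (quot_pi I \o alg_str A) r.
Proof. by rewrite -[u]quot_reprK /= -!rmorphM /= alg_central. Qed.

Definition quot_alg : algebra R := Algebra quot_alg_central.

Variables (i : involution A) (sI : stable i I).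

Definition quot_inv_fun (u : quot_alg) : quot_alg :=
  quot_pi I (i (quot_repr u)).

Lemma quot_inv_pi x : quot_inv_fun (quot_pi I x) = quot_pi I (i x).
Proof.
apply/quot_piP; rewrite -involutionB -sI; apply/asboolP.
eexists; last by [].
by apply/quot_piP; rewrite quot_reprK.
Qed.

Fact quot_invD : {morph quot_inv_fun : u v / u + v}.
Proof.
move=> u v; rewrite -[u]quot_reprK -[v]quot_reprK -raddfD /=.
by rewrite !quot_inv_pi involutionD raddfD.
Qed.

Fact quot_invZ r u :
  quot_inv_fun (alg_str quot_alg r * u) = alg_str quot_alg r * quot_inv_fun u.
Proof.
rewrite -[u]quot_reprK /= -rmorphM /=.
by rewrite !quot_inv_pi involutionZ rmorphM.
Qed.

Fact quot_invM u v : quot_inv_fun (u * v) = quot_inv_fun v * quot_inv_fun u.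
Proof.
rewrite -[u]quot_reprK -[v]quot_reprK -rmorphM /=.
by rewrite !quot_inv_pi involutionM rmorphM.
Qed.

Fact quot_invK : involutive quot_inv_fun.
Proof. by move=> u; rewrite -[u]quot_reprK !quot_inv_pi involutionK. Qed.

Definition quot_inv : involution quot_alg :=
  Involution quot_invD quot_invZ quot_invM quot_invK.
End QuotientAlgebra.

Definition submodule A (S : {pred A}) : Prop :=
  zmod_closed S /\ (forall r x, x \in S -> alg_str A r * x \in S).

(* [J p], for [p < k], are the summands; [I m] is the sum of the first [m] of
   them, so that [I 0 = 0] and the [p]-th subquotient is [I p.+1 / I p].  The
   stability [sI] follows from that of the summands; it is named because the
   induced involution depends on it. *)
Definition cellular_wrt A (i : involution A) : Prop :=
  exists (k : nat) (J : 'I_k -> {pred A}) (I : nat -> ideal A)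
         (sI : forall m, stable i (I m)),
  [/\ forall p, submodule (J p),
      forall x, exists! y : {ffun 'I_k -> A},
        (forall p, y p \in J p) /\ x = \sum_p y p,
      forall p, stable i (J p),
      forall m x, x \in I m <-> exists y : 'I_k -> A,
        (forall p, y p \in J p) /\ x = \sum_(p < k | (p < m)%N) y p
    & forall p : 'I_k, cell_ideal (quot_inv (sI p)) (quot_ideal (I p) (I p.+1))].

Definition cellular A : Prop := exists i : involution A, cellular_wrt i.

End Cellular.

Section Centrosymmetric.
Variables (R : pzRingType) (n : nat).

(* [rev_ord i] has value [n - 1 - i], the 0-based form of [n + 1 - i]. *)
Definition centrosymmetric : {pred 'M[R]_n} :=
  fun a => [forall i, forall j, a i j == a (rev_ord i) (rev_ord j)].

Lemma centrosymmetricP (a : 'M[R]_n) :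
  reflect (forall i j, a i j = a (rev_ord i) (rev_ord j))
          (a \in centrosymmetric).
Proof.
apply: (iffP forallP) => [h i j|h i]; first by have /forallP/(_ j)/eqP := h i.
by apply/forallP => j; apply/eqP.
Qed.

Fact centrosymmetric_subring : subring_closed centrosymmetric.
Proof.
split=> [|a b /centrosymmetricP ha /centrosymmetricP hb|
         a b /centrosymmetricP ha /centrosymmetricP hb];
  apply/centrosymmetricP => i j.
- by rewrite !mxE (inj_eq rev_ord_inj).
- by rewrite !mxE ha hb.
- rewrite !mxE (reindex_inj rev_ord_inj) /=.
  by apply: eq_bigr => k _; rewrite ha hb !rev_ordK.
Qed.

HB.instance Definition _ :=
  GRing.isSubringClosed.Build 'M[R]_n centrosymmetric centrosymmetric_subring.

Definition centro_ring : pzRingType := subring centrosymmetric.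
End Centrosymmetric.

Arguments centrosymmetric : clear implicits.

Section CentrosymmetricAlgebra.
Variables (R : comPzRingType) (n : nat).

Fact scalar_centrosymmetric (r : R) : r%:M \in centrosymmetric R n.
Proof.
by apply/centrosymmetricP => i j; rewrite !mxE (inj_eq rev_ord_inj).
Qed.

Definition centro_scalar (r : R) : centro_ring R n :=
  Sub (r%:M : 'M[R]_n) (scalar_centrosymmetric r).

Fact centro_scalar_zmod : zmod_morphism centro_scalar.
Proof. by move=> r s; apply: val_inj; rewrite /= raddfB. Qed.

Fact centro_scalar_monoid : monoid_morphism centro_scalar.
Proof. by split=> [|r s]; apply: val_inj; rewrite /= ?rmorphM. Qed.

HB.instance Definition _ := GRing.isZmodMorphism.Build R (centro_ring R n)
  centro_scalar centro_scalar_zmod.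
HB.instance Definition _ := GRing.isMonoidMorphism.Build R (centro_ring R n)
  centro_scalar centro_scalar_monoid.

Fact centro_central r (x : centro_ring R n) :
  centro_scalar r * x = x * centro_scalar r.
Proof. by apply: val_inj; exact: comm_scalar_mx. Qed.

Definition centro_alg : algebra R := Algebra centro_central.
End CentrosymmetricAlgebra.

(* Main.v *)
(** Part (1). For n >= 2 the trace form T(x) = x + JxJ, with J the antidiagonal
    permutation matrix, is an S_n(R)-bimodule map M_n(R) -> S_n(R) with dual
    bases u_l = E_{l0}, v_l = E_{0l}, i.e.
    x = sum_l T(x u_l) v_l = sum_l u_l T(v_l x), because J moves the index 0.
    Hence the extension is Frobenius, and it is separable since the Casimir
    element sum_l u_l (x) v_l multiplies to 1.  For n = 1 the extension is
    trivial.  Moreover S_2(R), resp. S_3(R), is the corner e S_n(R) e of the full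
    idempotent e projecting on the first and last, resp. first, middle and last,
    coordinates.

    Part (2). The involution is transposition.  A cell basis is given by the
    matrices chi_p chi_q^T, where chi_p is the indicator of the J-orbit of p,
    and by E_{pq} + E_{p'q'} for p, q strictly in the first half and p', q'
    their images under J; the former span a two-sided ideal, namely the
    matrices with J-symmetric columns and rows. *)

From HB Require Import structures.
Require Import Defs.
From mathcomp Require Import all_boot all_order all_algebra.
From mathcomp Require Import boolp zify.
From mathcomp.multinomials Require Import freeg.

Set Implicit Arguments.
Unset Strict Implicit.
Unset Printing Implicit Defensive.

Import GRing.Theory.
Local Open Scope ring_scope.
Local Open Scope quotient_scope.

(** * Separable Frobenius extensions *)

Lemma morphD_0 (U V : zmodType) (f : U -> V) :
  {morph f : x y / x + y} -> f 0 = 0.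
Proof. by move=> fD; apply: (@addIr _ (f 0)); rewrite -fD !add0r. Qed.

Lemma morphB_D (U V : zmodType) (f : U -> V) :
  {morph f : x y / x - y} -> {morph f : x y / x + y}.
Proof.
move=> fB x y; have f0 : f 0 = 0 by rewrite -[X in f X](subrr 0) fB subrr.
have fN : f (- y) = - f y by rewrite -[- y]sub0r fB f0 sub0r.
by rewrite -{1}[y]opprK fB fN opprK.
Qed.

Lemma morphD_sum (U V : zmodType) (f : U -> V) (I : Type) (r : seq I)
    (P : pred I) (F : I -> U) : {morph f : x y / x + y} ->
  f (\sum_(i <- r | P i) F i) = \sum_(i <- r | P i) f (F i).
Proof. by move=> fD; apply: big_morph => //; exact: morphD_0. Qed.

(** * Additive maps out of a tensor product *)

Section TensorTheory.
Variables (B : Type) (M N : zmodType) (ra : M -> B -> M) (la : B -> N -> N).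

Lemma tensDl y : {morph (tens ra la)^~ y : x x' / x + x'}.
Proof. by case: (tens_balanced ra la). Qed.

Lemma tensDr x : {morph tens ra la x : y y' / y + y'}.
Proof. by case: (tens_balanced ra la). Qed.

Lemma tens_act x b y : tens ra la (ra x b) y = tens ra la x (la b y).
Proof. by case: (tens_balanced ra la). Qed.

Lemma tens_suml (I : Type) (r : seq I) (P : pred I) (F : I -> M) y :
  tens ra la (\sum_(i <- r | P i) F i) y =
  \sum_(i <- r | P i) tens ra la (F i) y.
Proof. exact/(morphD_sum _ _ _ (f := (tens ra la)^~ y))/tensDl. Qed.

Lemma tens_sumr (I : Type) (r : seq I) (P : pred I) (F : I -> N) x :
  tens ra la x (\sum_(i <- r | P i) F i) =
  \sum_(i <- r | P i) tens ra la x (F i).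
Proof. exact/morphD_sum/tensDr. Qed.

(** Pulled back along the quotient map, both sides are additive on the free abelian group, where
    induction on the number of terms leaves integer multiples of one generator. Natural multiples
    follow by additivity, negative ones by cancelling the opposite multiple. *)
Lemma tens_eqD (G : zmodType) (f g : tensor ra la -> G) :
    {morph f : t u / t + u} -> {morph g : t u / t + u} ->
  (forall x y, f (tens ra la x y) = g (tens ra la x y)) -> f =1 g.
Proof.
move=> fD gD fg t.
pose q := \pi_(Quotient.quot (tensor_ker ra la)).
have fqD : {morph (fun d => f (q d)) : d e / d + e}.
  by move=> d e; rewrite -fD; congr (f _); exact: raddfD.
have gqD : {morph (fun d => g (q d)) : d e / d + e}.
  by move=> d e; rewrite -gD; congr (g _); exact: raddfD.
suff fgq d : f (q d) = g (q d).
  by have := fgq (repr (t : Quotient.quot _)); rewrite /q reprK.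
elim/freeg_ind_dom0: d => [|k [x y] d _ _ IHd].
  by rewrite (morphD_0 fqD) (morphD_0 gqD).
rewrite fqD gqD IHd; congr (_ + _).
have natE (m : nat) : f (q << m%:Z *g (x, y) >>) = g (q << m%:Z *g (x, y) >>).
  elim: m => [|m IHm]; first by rewrite freegU0 (morphD_0 fqD) (morphD_0 gqD).
  by rewrite -addn1 PoszD -freegUD fqD gqD IHm fg.
case: k => m; first exact: natE.
rewrite NegzE -freegUN; apply: (@addIr _ (f (q << m.+1%:Z *g (x, y) >>))).
rewrite -fqD [in RHS]natE -gqD !addNr.
by rewrite (morphD_0 fqD) (morphD_0 gqD).
Qed.

Lemma tens_liftD (G : zmodType) (h : M -> N -> G) :
  balanced ra la h -> {morph @tens_lift B M N ra la G h : t u / t + u}.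
Proof. by move=> hb; apply/morphB_D/tens_liftB. Qed.

End TensorTheory.

(** * Extensions with a bimodule form [T] and dual bases [u], [v] *)

Section SeparableFrobenius.
Variables (A : pzRingType) (S : subringClosed A) (T : A -> subring S).
Variables (k : nat) (u v : 'I_k -> A).

Hypothesis TD : {morph T : x y / x + y}.
Hypothesis Tl : forall (b : subring S) x, T (val b * x) = b * T x.
Hypothesis Tr : forall x (b : subring S), T (x * val b) = T x * b.
Hypothesis dual_l : forall x, x = \sum_l val (T (x * u l)) * v l.
Hypothesis dual_r : forall x, x = \sum_l u l * val (T (v l * x)).

Let trace_form (y x : ext_lmod A) : (subring S)^o := T ((x : A) * (y : A)).

Let trace_form_is_linear y : linear (trace_form y).
Proof.
move=> b x x'; rewrite /trace_form mulrDl TD; congr (_ + _).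
by rewrite -mulrA Tl.
Qed.

HB.instance Definition _ y :=
  GRing.isLinear.Build (subring S) (ext_lmod A) (subring S)^o _ (trace_form y)
    (trace_form_is_linear y).

Lemma lin_dual_basis (N : lmodType (subring S))
    (f : {linear ext_lmod A -> N}) (x : A) :
  f x = \sum_l T (x * u l) *: f (v l).
Proof.
rewrite [in LHS](dual_l x) (raddf_sum f); apply: eq_bigr => l _.
by rewrite -linearZ.
Qed.

Section Lift.
Variables (M : lmodType (subring S)) (m : 'I_k -> M).

Let dual_lift (x : ext_lmod A) : M := \sum_l T ((x : A) * u l) *: m l.

Let dual_lift_is_linear : linear dual_lift.
Proof.
move=> b x x'; rewrite /dual_lift scaler_sumr -big_split; apply: eq_bigr => l _.
by rewrite /= mulrDl TD scalerDl -mulrA Tl scalerA.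
Qed.

HB.instance Definition _ := GRing.isLinear.Build (subring S) (ext_lmod A) M _
  dual_lift dual_lift_is_linear.

(** When each [m l] is a preimage of [f (v l)], this map lifts [f]; that is how projectivity is
    obtained. *)
Lemma dual_lift_exists :
  exists g : {linear ext_lmod A -> M},
    forall x : A, g x = \sum_l T (x * u l) *: m l.
Proof. by exists dual_lift. Qed.
End Lift.

(** The isomorphism sends [y] to the functional T(- y). A functional f is hit by sum_l u_l f(v_l),
    by [dual_l]; and [dual_r] recovers [y] from the values T(v_l y), which gives uniqueness. *)
Lemma Frobenius_of_dual_basis : Frobenius_extension S.
Proof.
split.
- by exists k, v => x; exists (fun l => T (x * u l)); exact: dual_l.
- move=> M N p f psurj.
  have [m mE] := choice (fun l : 'I_k => psurj (f (v l))).
  have [g gE] := dual_lift_exists m; exists g => x /=.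
  rewrite gE (lin_dual_basis f) raddf_sum; apply: eq_bigr => l _.
  by rewrite [LHS]linearZ_LR mE.
exists (fun y => trace_form y : {linear ext_lmod A -> (subring S)^o}).
split=> [y z x|a y b x|f] /=.
- by rewrite /trace_form mulrDr TD.
- by rewrite /trace_form mulrA Tr mulrA.
pose y := \sum_l u l * val (f (v l) : subring S).
exists y; split=> [x|z zf] /=.
  rewrite /trace_form /y (lin_dual_basis f) mulr_sumr (morphD_sum _ _ _ TD).
  by apply: eq_bigr => l _; rewrite mulrA Tr.
by rewrite (dual_r z); apply: eq_bigr => l _; rewrite -zf.
Qed.

Hypothesis Casimir1 : \sum_l u l * v l = 1.

Let ten : A -> A -> tensAA S :=
  tens (fun (x : A) (b : subring S) => x * val b)
       (fun (b : subring S) (y : A) => val b * y).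

(** The section is a |-> a . sum_l u_l (x) v_l. It is right linear because the Casimir element
    commutes with every b: expand v_l b in the [v j], carry the coefficients T(v_l b u_j) across the
    tensor sign, and resum on the left to b u_j by [dual_r]. *)
Lemma separable_of_dual_basis : separable_extension S.
Proof.
exists (fun a => \sum_l ten (a * u l) (v l)); split=> [x y|a x b|x].
- by rewrite -big_split; apply: eq_bigr => l _; rewrite mulrDl /ten tensDl.
- rewrite /tensAA_act
    (morphD_sum _ _ _ (tens_liftD (tensAA_act_balanced S a b))).
  under [RHS]eq_bigr => l _.
    rewrite (tens_lift_tens (tensAA_act_balanced S a b)) mulrA.
    rewrite (dual_l (v l * b)) tens_sumr.
    under eq_bigr => j _ do rewrite -tens_act.
    over.
  rewrite exchange_big; apply: eq_bigr => l _ /=.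
  rewrite -tens_suml; congr (tens _ _ _ _).
  rewrite -[LHS]mulrA [b * u l]dual_r mulr_sumr.
  by apply: eq_bigr => j _; rewrite !mulrA.
rewrite /tensAA_mul (morphD_sum _ _ _ (tens_liftD (tensAA_mul_balanced S))).
under eq_bigr => l _ do rewrite (tens_lift_tens (tensAA_mul_balanced S)) -mulrA.
by rewrite -mulr_sumr Casimir1 mulr1.
Qed.

End SeparableFrobenius.

(** * Conjugation by the antidiagonal, and the trace form on M_n(R) *)

Section Rotation.
Variable R : pzRingType.

(** This is J x J with J of the two respective sizes. The rectangular case is used for the matrices
    linking S_n(R) to a smaller S_s(R). *)
Definition rot_mx m n (x : 'M[R]_(m, n)) : 'M[R]_(m, n) :=
  \matrix_(i, j) x (rev_ord i) (rev_ord j).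

Lemma rot_mxM m n p (x : 'M[R]_(m, n)) (y : 'M[R]_(n, p)) :
  rot_mx (x *m y) = rot_mx x *m rot_mx y.
Proof.
apply/matrixP => i j; rewrite !mxE (reindex_inj rev_ord_inj) /=.
by apply: eq_bigr => k _; rewrite !mxE.
Qed.

Lemma rot_mxD m n (x y : 'M[R]_(m, n)) : rot_mx (x + y) = rot_mx x + rot_mx y.
Proof. by apply/matrixP => i j; rewrite !mxE. Qed.

Lemma rot_mxK m n : involutive (@rot_mx m n).
Proof. by move=> x; apply/matrixP => i j; rewrite !mxE !rev_ordK. Qed.

Lemma rot_delta_mx m n (i : 'I_m) (j : 'I_n) :
  rot_mx (delta_mx i j) = delta_mx (rev_ord i) (rev_ord j).
Proof.
by apply/matrixP => a b; rewrite !mxE -!(can2_eq rev_ordK rev_ordK).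
Qed.

Variable n : nat.
Implicit Types x y : 'M[R]_n.

Lemma centro_rotP x : reflect (rot_mx x = x) (x \in centrosymmetric R n).
Proof.
apply: (iffP (centrosymmetricP x)) => [h|h i j].
  by apply/matrixP => i j; rewrite mxE -h.
by rewrite -[in LHS]h mxE.
Qed.

Lemma rot_centro (b : centro_ring R n) : rot_mx (val b) = val b.
Proof. exact/centro_rotP/(valP b). Qed.

Fact rot_trace_subproof x : x + rot_mx x \in centrosymmetric R n.
Proof. by apply/centro_rotP; rewrite rot_mxD rot_mxK addrC. Qed.

Definition rot_trace x : centro_ring R n :=
  Sub (x + rot_mx x) (rot_trace_subproof x).

End Rotation.

Lemma rev_ord0 n : (0 < n)%N -> (ord0 == rev_ord ord0 :> 'I_n.+1) = false.
Proof. by case: n. Qed.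

Lemma centro_separable_Frobenius (R : pzRingType) (n : nat) :
  (0 < n)%N -> separable_Frobenius_extension (centrosymmetric R n).
Proof.
case: n => // -[|n] _.
  (* In size 1 the only index is fixed by J and [rot_trace] would be doubling; the identity map with
     dual bases 1, 1 is taken instead. *)
  have all_centro (x : 'M[R]_1) : x \in centrosymmetric R 1.
    by apply/centrosymmetricP => i j; rewrite !ord1.
  pose T x : centro_ring R 1 := Sub x (all_centro x).
  split; [apply: (@separable_of_dual_basis _ _ T 1 (fun=> 1) (fun=> 1))
        | apply: (@Frobenius_of_dual_basis _ _ T 1 (fun=> 1) (fun=> 1))];
    by move=> *; rewrite ?big_ord1 ?mulr1 ?mul1r //; apply: val_inj.
pose z : 'I_n.+2 := ord0.
pose u (l : 'I_n.+2) := delta_mx l z : 'M[R]_n.+2.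
pose v (l : 'I_n.+2) := delta_mx z l : 'M[R]_n.+2.
have zF : (z == rev_ord z) = false by exact: rev_ord0.
have uv1 : \sum_l u l * v l = 1.
  rewrite -[1]/(1%:M) [RHS]mx1_sum_delta.
  by apply: eq_bigr => l _; rewrite -[LHS]/(_ *m _) mul_delta_mx.
have TD : {morph @rot_trace R n.+2 : x y / x + y}.
  by move=> x y; apply: val_inj; rewrite /= rot_mxD addrACA.
have Tl (b : centro_ring R n.+2) x : rot_trace (val b *m x) = b * rot_trace x.
  by apply: val_inj; rewrite /= rot_mxM rot_centro mulrDr.
have Tr x (b : centro_ring R n.+2) : rot_trace (x *m val b) = rot_trace x * b.
  by apply: val_inj; rewrite /= rot_mxM rot_centro mulrDl.
(* The summand x u_l of the trace already gives x, since sum_l u_l v_l = 1. The rotated summand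
   contains E_{l'z'} E_{zl}, which is 0 because z' differs from z; the other expansion is
   symmetric. *)
have dl x : x = \sum_l val (rot_trace (x * u l)) * v l.
  rewrite -{1}[x]mulr1 -uv1 mulr_sumr; apply: eq_bigr => l _.
  rewrite /= mulrDl -mulrA [X in _ + X](_ : _ = 0) ?addr0 //.
  rewrite -[X in X = 0]/(rot_mx (x *m u l) *m v l) rot_mxM rot_delta_mx.
  by rewrite -mulmxA mul_delta_mx_0 ?mulmx0 // eq_sym zF.
have dr x : x = \sum_l u l * val (rot_trace (v l * x)).
  rewrite -{1}[x]mul1r -uv1 mulr_suml; apply: eq_bigr => l _.
  rewrite /= mulrDr mulrA [X in _ + X](_ : _ = 0) ?addr0 //.
  rewrite -[X in X = 0]/(u l *m rot_mx (v l *m x)) rot_mxM rot_delta_mx.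
  by rewrite mulmxA mul_delta_mx_0 ?mul0mx // zF.
by split; [apply: (separable_of_dual_basis dl dr)
         | apply: (Frobenius_of_dual_basis TD Tl Tr dl dr)].
Qed.

(** * Morita equivalence with a full corner *)

(* [phi] identifies [B] with the corner [e A e] of the full idempotent
   [e = phi 1]; it is not unital as a map to [A]. *)
Section CornerMorita.
Variables (A B : pzRingType) (phi : B -> A) (psi : A -> B).
Variables (k : nat) (x y : 'I_k -> A).

Hypothesis phiD : {morph phi : b c / b + c}.
Hypothesis phiM : {morph phi : b c / b * c}.
Hypothesis phiK : cancel phi psi.
Hypothesis psiK : forall a, phi (psi a) = phi 1 * a * phi 1.
Hypothesis full : \sum_i x i * phi 1 * y i = 1.

Let phi_inj : injective phi. Proof. exact: can_inj phiK. Qed.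

Let phi1M b : phi 1 * phi b = phi b. Proof. by rewrite -phiM mul1r. Qed.
Let phiM1 b : phi b * phi 1 = phi b. Proof. by rewrite -phiM mulr1. Qed.

Let psiD : {morph psi : a b / a + b}.
Proof. by move=> a b; apply: phi_inj; rewrite phiD !psiK mulrDr mulrDl. Qed.

Let psiM a b : psi a * psi b = psi (a * phi 1 * b).
Proof.
by apply: phi_inj; rewrite phiM !psiK -!mulrA (mulrA (phi 1) (phi 1)) phi1M.
Qed.

Let psi1 : psi 1 = 1.
Proof. by apply: phi_inj; rewrite psiK mulr1 phi1M. Qed.

Let psi_phil b a : psi (phi b * a) = b * psi a.
Proof. by rewrite -{2}[b]phiK psiM phiM1. Qed.

Let psi_1r a : psi (a * phi 1) = psi a.
Proof. by rewrite -[phi 1]mulr1 mulrA -psiM psi1 mulr1. Qed.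

(** Insert 1 = sum_j x_j e y_j between [a] and [b], where e = [phi 1]. Taking a = y_i and b = x_l
    shows that the matrix [psi (y i * x j)] is idempotent. *)
Let psi_sum a b : \sum_j psi (a * x j) * psi (y j * b) = psi (a * b).
Proof.
rewrite -{2}[a]mulr1 -full mulr_sumr mulr_suml (morphD_sum _ _ _ psiD).
by apply: eq_bigr => j _; rewrite psiM !mulrA.
Qed.

Section CornerModule.
Variable M : lmodType A.

(** The submodule e M, described as the fixed points of the idempotent e = [phi 1]. *)
Definition corner_pred : {pred M} := fun m => phi 1 *: m == m.

Fact corner_pred_zmod : zmod_closed corner_pred.
Proof.
split=> [|m m']; rewrite !unfold_in ?scaler0 //.
by move=> /eqP hm /eqP hm'; rewrite scalerBr hm hm'.
Qed.

HB.instance Definition _ :=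
  GRing.isZmodClosed.Build M corner_pred corner_pred_zmod.

Definition corner : Type := {m : M | m \in corner_pred}.

HB.instance Definition _ := SubChoice.copy corner {m : M | m \in corner_pred}.
HB.instance Definition _ := [SubChoice_isSubZmodule of corner by <:].

Lemma corner1 (m : corner) : phi 1 *: val m = val m.
Proof. exact/eqP/(valP m). Qed.

Fact corner_scale_subproof b (m : M) : phi b *: m \in corner_pred.
Proof. by rewrite unfold_in scalerA phi1M. Qed.

Definition corner_scale b (m : corner) : corner :=
  Sub (phi b *: val m) (corner_scale_subproof b _).

Fact corner_scaleA b c m :
  corner_scale b (corner_scale c m) = corner_scale (b * c) m.
Proof. by apply: val_inj; rewrite /= scalerA phiM. Qed.
Fact corner_scale1 : left_id 1 corner_scale.
Proof. by move=> m; apply: val_inj; rewrite /= corner1. Qed.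
Fact corner_scaleDr : right_distributive corner_scale +%R.
Proof. by move=> b m m'; apply: val_inj; rewrite /= scalerDr. Qed.
Fact corner_scaleDl m : {morph corner_scale^~ m : b c / b + c}.
Proof. by move=> b c; apply: val_inj; rewrite /= phiD scalerDl. Qed.

HB.instance Definition _ := GRing.Zmodule_isLmodule.Build B corner
  corner_scaleA corner_scale1 corner_scaleDr corner_scaleDl.

End CornerModule.
Arguments corner_pred : clear implicits.

Section CornerMap.
Variables (M N : lmodType A) (f : {linear M -> N}).

Fact corner_map_subproof (m : corner M) : f (val m) \in corner_pred N.
Proof. by rewrite unfold_in -linearZ_LR corner1. Qed.

Definition corner_map (m : corner M) : corner N :=
  Sub (f (val m)) (corner_map_subproof m).

Fact corner_map_linear : linear corner_map.
Proof.
by move=> b m m'; apply: val_inj; rewrite /= linearD linearZ_LR.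
Qed.

HB.instance Definition _ := GRing.isLinear.Build B (corner M) (corner N) _
  corner_map corner_map_linear.
End CornerMap.

Fact corner_map_ext (M N : lmodType A) (f g : {linear M -> N}) :
  f =1 g -> corner_map f =1 corner_map g.
Proof. by move=> fg m; apply: val_inj; exact: fg. Qed.

Fact corner_map_id (M : lmodType A) :
  corner_map (idfun : {linear M -> M}) =1 idfun.
Proof. by move=> m; apply: val_inj. Qed.

Fact corner_map_comp (M N P : lmodType A)
    (g : {linear N -> P}) (f : {linear M -> N}) :
  corner_map (g \o f : {linear M -> P}) =1 corner_map g \o corner_map f.
Proof. by move=> m; apply: val_inj. Qed.

Definition corner_functor : modFunctor A B :=
  @ModFunctor A B (fun M => corner M : lmodType B)
    (fun M N f => corner_map f : {linear corner M -> corner N})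
    corner_map_ext corner_map_id corner_map_comp.

(* The [A]-module [A phi(1) (x)_B N], embedded in [N ^ k] as the image of the
   idempotent matrix [psi (y i * x j)]. *)
Section InducedModule.
Variable N : lmodType B.

Definition induced_pred : {pred {ffun 'I_k -> N}} :=
  fun v => [forall i, \sum_j psi (y i * x j) *: v j == v i].

Lemma induced_predP (v : {ffun 'I_k -> N}) :
  reflect (forall i, \sum_j psi (y i * x j) *: v j = v i) (v \in induced_pred).
Proof. by apply: (iffP forallP) => h i; apply/eqP. Qed.

Fact induced_pred_zmod : zmod_closed induced_pred.
Proof.
split=> [|v w /induced_predP hv /induced_predP hw]; apply/induced_predP => i.
  by rewrite ffunE big1 // => j _; rewrite ffunE scaler0.
rewrite !ffunE -hv -hw -sumrB; apply: eq_bigr => j _.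
by rewrite !ffunE scalerBr.
Qed.

HB.instance Definition _ :=
  GRing.isZmodClosed.Build {ffun 'I_k -> N} induced_pred induced_pred_zmod.

Definition induced : Type := {v : {ffun 'I_k -> N} | v \in induced_pred}.

HB.instance Definition _ :=
  SubChoice.copy induced {v : {ffun 'I_k -> N} | v \in induced_pred}.
HB.instance Definition _ := [SubChoice_isSubZmodule of induced by <:].

Definition induced_of v (hv : v \in induced_pred) : induced := Sub v hv.
Arguments induced_of [v] hv /.

Lemma induced1 (v : induced) i : \sum_j psi (y i * x j) *: val v j = val v i.
Proof. by have /induced_predP := valP v. Qed.

Lemma induced_inj (v w : induced) : (forall i, val v i = val w i) -> v = w.
Proof. by move=> vw; apply: val_inj; apply/ffunP. Qed.

(** Multiplicativity of a |-> (psi (y_i a x_j)) as matrices, by contracting the inner index with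
    [psi_sum]. Stability of the image and associativity of the action are both instances. *)
Lemma induced_sum (v : {ffun 'I_k -> N}) a b :
  \sum_i psi (a * x i) *: (\sum_j psi (y i * b * x j) *: v j) =
  \sum_j psi (a * b * x j) *: v j.
Proof.
under eq_bigr => i _ do rewrite scaler_sumr.
rewrite exchange_big; apply: eq_bigr => j _ /=.
rewrite -mulrA -psi_sum scaler_suml; apply: eq_bigr => i _.
by rewrite scalerA !mulrA.
Qed.

Fact induced_scale_subproof a (v : {ffun 'I_k -> N}) :
  [ffun i => \sum_j psi (y i * a * x j) *: v j] \in induced_pred.
Proof.
apply/induced_predP => i; rewrite ffunE -[RHS]induced_sum.
by apply: eq_bigr => j _; rewrite /= ffunE.
Qed.

(** The family v stands for sum_j x_j e (x) v_j, and an element c e (x) z has i-th coordinate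
    psi(y_i c) z; left multiplication by [a] is therefore the matrix psi(y_i a x_j). *)
Definition induced_scale a (v : induced) : induced :=
  induced_of (induced_scale_subproof a (val v)).

Fact induced_scaleA a b v :
  induced_scale a (induced_scale b v) = induced_scale (a * b) v.
Proof.
apply: induced_inj => i; rewrite /= !ffunE mulrA -[RHS]induced_sum.
by apply: eq_bigr => j _; rewrite /= ffunE.
Qed.
Fact induced_scale1 : left_id 1 induced_scale.
Proof.
move=> v; apply: induced_inj => i; rewrite /= ffunE -[RHS]induced1.
by apply: eq_bigr => j _; rewrite mulr1.
Qed.
Fact induced_scaleDr : right_distributive induced_scale +%R.
Proof.
move=> a v w; apply: induced_inj => i; rewrite /= !ffunE -big_split.
by apply: eq_bigr => j _; rewrite /= ffunE scalerDr.
Qed.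
Fact induced_scaleDl v : {morph induced_scale^~ v : a b / a + b}.
Proof.
move=> a b; apply: induced_inj => i; rewrite /= !ffunE -big_split.
by apply: eq_bigr => j _; rewrite /= mulrDr mulrDl psiD scalerDl.
Qed.

HB.instance Definition _ := GRing.Zmodule_isLmodule.Build A induced
  induced_scaleA induced_scale1 induced_scaleDr induced_scaleDl.

Lemma val_induced_scale a (v : induced) i :
  val (a *: v) i = \sum_j psi (y i * a * x j) *: val v j.
Proof. exact: ffunE. Qed.

Lemma val_inducedD (v w : induced) i : val (v + w) i = val v i + val w i.
Proof. exact: ffunE. Qed.
End InducedModule.
Arguments induced_pred : clear implicits.
Arguments induced_of [N v] hv /.

Section InducedMap.
Variables (M N : lmodType B) (f : {linear M -> N}).

Fact induced_map_subproof (v : induced M) :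
  [ffun i => f (val v i)] \in induced_pred N.
Proof.
apply/induced_predP => i; rewrite ffunE -induced1 linear_sum.
by apply: eq_bigr => j _; rewrite ffunE linearZ_LR.
Qed.

Definition induced_map (v : induced M) : induced N :=
  induced_of (induced_map_subproof v).

Fact induced_map_linear : linear induced_map.
Proof.
move=> a v w; apply: induced_inj => i.
rewrite /= !ffunE linearD linear_sum; congr (_ + _).
by apply: eq_bigr => j _; rewrite ffunE linearZ_LR.
Qed.

HB.instance Definition _ := GRing.isLinear.Build A (induced M) (induced N) _
  induced_map induced_map_linear.
End InducedMap.

Fact induced_map_ext (M N : lmodType B) (f g : {linear M -> N}) :
  f =1 g -> induced_map f =1 induced_map g.
Proof. by move=> fg v; apply: induced_inj => i; rewrite !ffunE fg. Qed.

Fact induced_map_id (M : lmodType B) :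
  induced_map (idfun : {linear M -> M}) =1 idfun.
Proof. by move=> v; apply: induced_inj => i; rewrite ffunE. Qed.

Fact induced_map_comp (M N P : lmodType B)
    (g : {linear N -> P}) (f : {linear M -> N}) :
  induced_map (g \o f : {linear M -> P}) =1 induced_map g \o induced_map f.
Proof. by move=> v; apply: induced_inj => i; rewrite !ffunE. Qed.

Definition induced_functor : modFunctor B A :=
  @ModFunctor B A (fun M => induced M : lmodType A)
    (fun M N f => induced_map f : {linear induced M -> induced N})
    induced_map_ext induced_map_id induced_map_comp.

Section Unit.
Variable M : lmodType A.

Definition unit_coord (m : M) i : corner M :=
  Sub (phi 1 *: (y i *: m)) (corner_scale_subproof 1 _).

Lemma unit_coord_sum a (m : M) i :
  \sum_j psi (y i * a * x j) *: unit_coord m j = unit_coord (a *: m) i.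
Proof.
apply: val_inj; rewrite raddf_sum /= -[m in RHS]scale1r -full scaler_suml.
rewrite !scaler_sumr; apply: eq_bigr => j _.
by rewrite psiK !scalerA !mulrA -(mulrA _ (phi 1) (phi 1)) phi1M.
Qed.

Fact unit_fun_subproof (m : M) :
  [ffun i => unit_coord m i] \in induced_pred (corner M).
Proof.
apply/induced_predP => i; rewrite ffunE -[m in RHS]scale1r -unit_coord_sum.
by apply: eq_bigr => j _; rewrite ffunE mulr1.
Qed.

Definition unit_fun (m : M) : induced (corner M) :=
  induced_of (unit_fun_subproof m).

Fact unit_fun_linear : linear unit_fun.
Proof.
move=> a m m'; apply: induced_inj => i.
rewrite val_inducedD val_induced_scale !ffunE.
under eq_bigr => j _ do rewrite ffunE.
by rewrite unit_coord_sum; apply: val_inj; rewrite /= !scalerDr.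
Qed.

HB.instance Definition _ := GRing.isLinear.Build A M (induced (corner M)) _
  unit_fun unit_fun_linear.

(** The inverse is v |-> sum_i x_i v_i. One composite is the identity by fullness, the other by the
    idempotent equation defining the induced module. *)
Lemma unit_fun_bij : bijective unit_fun.
Proof.
exists (fun v : induced (corner M) => \sum_i x i *: val (val v i)) => [m|v].
  rewrite -[RHS]scale1r -full scaler_suml.
  by apply: eq_bigr => i _; rewrite ffunE /= !scalerA.
apply: induced_inj => i; rewrite ffunE -[RHS]induced1; apply: val_inj.
rewrite raddf_sum /= !scaler_sumr; apply: eq_bigr => j _.
by rewrite psiK -{1}(corner1 (val v j)) !scalerA !mulrA.
Qed.
End Unit.

Section Counit.
Variable N : lmodType B.

(** The identification e (A e (x)_B N) = N, under which x_i e (x) w_i becomes psi(x_i) w_i. *)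
Definition counit_fun (w : corner (induced N)) : N :=
  \sum_i psi (x i) *: val (val w) i.

Fact counit_fun_linear : linear counit_fun.
Proof.
move=> b w w'; rewrite /counit_fun.
(* The scalar b acts on the corner through [phi b]; the factor 1 put in front of x_i lets
   [induced_sum] contract with a = 1. *)
have -> : b *: (\sum_i psi (x i) *: val (val w) i) =
    \sum_i psi (x i) *: val (phi b *: val w) i.
  under [RHS]eq_bigr => i _ do rewrite val_induced_scale -[x i]mul1r.
  rewrite induced_sum scaler_sumr; apply: eq_bigr => i _.
  by rewrite scalerA mul1r psi_phil.
rewrite -big_split; apply: eq_bigr => i _.
by rewrite /= ffunE scalerDr.
Qed.

HB.instance Definition _ := GRing.isLinear.Build B (corner (induced N)) N _
  counit_fun counit_fun_linear.

Fact counit_inv_subproof (z : N) :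
  [ffun i => psi (y i) *: z] \in induced_pred N.
Proof.
apply/induced_predP => i; rewrite ffunE -[y i in RHS]mulr1 -psi_sum scaler_suml.
by apply: eq_bigr => j _; rewrite ffunE scalerA mulr1.
Qed.

Fact counit_inv_corner (z : N) :
  (induced_of (counit_inv_subproof z) : induced N) \in corner_pred (induced N).
Proof.
rewrite unfold_in; apply/eqP; apply: induced_inj => i.
rewrite val_induced_scale ffunE -[psi (y i)]psi_1r -[in RHS](mulr1 (_ * _)).
rewrite -psi_sum scaler_suml; apply: eq_bigr => j _.
by rewrite ffunE scalerA mulr1.
Qed.

(** The inverse is z |-> (psi(y_i) z)_i. Going through N turns w into the family sum_j psi(y_i e
    x_j) w_j, which is e w = w. *)
Lemma counit_fun_bij : bijective counit_fun.
Proof.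
exists (fun z => Sub (induced_of (counit_inv_subproof z))
                     (counit_inv_corner z) : corner (induced N)) => [w|z].
  apply: val_inj; apply: induced_inj => i; rewrite ffunE.
  rewrite -[in RHS](corner1 w) val_induced_scale scaler_sumr.
  by apply: eq_bigr => j _; rewrite scalerA psiM.
rewrite /counit_fun -[RHS]scale1r -psi1 -[X in psi X]mulr1 -psi_sum scaler_suml.
by apply: eq_bigr => i _; rewrite ffunE scalerA mul1r mulr1.
Qed.
End Counit.

Lemma corner_Morita : Morita_equivalent A B.
Proof.
exists corner_functor, induced_functor.
exists (fun M : lmodType A => @unit_fun M : {linear M -> induced (corner M)}).
exists (fun N : lmodType B => @counit_fun N : {linear corner (induced N) -> N}).
split=> [M|M M' f m|N|N N' g w].
- exact: unit_fun_bij.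
- apply: induced_inj => i; apply: val_inj.
  by rewrite /= !ffunE /= !linearZ_LR.
- exact: counit_fun_bij.
- rewrite /= /counit_fun linear_sum; apply: eq_bigr => i _.
  by rewrite /= ffunE linearZ_LR.
Qed.

End CornerMorita.

Definition centro_of (R : pzRingType) (n : nat) (a : 'M[R]_n)
  (ha : a \in centrosymmetric R n) : centro_ring R n := Sub a ha.
Arguments centro_of {R n a} ha /.

(** * Corners of S_n(R) on a reversal-stable set of coordinates *)

Section CentrosymmetricCorner.
Variables (R : pzRingType) (n s : nat).
Variables (g : 'I_s -> 'I_n) (c : 'I_n -> 'I_s) (z : 'I_s).
Hypothesis g_inj : injective g.
Hypothesis g_rev : forall j, g (rev_ord j) = rev_ord (g j).
Hypothesis g_fix : forall i, rev_ord i = i -> g (c i) = i.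
Hypothesis z_free : z != rev_ord z.

(** [P] includes the chosen coordinates and [Q] projects onto them. As Q P = 1, the product P Q is
    an idempotent e, and b |-> P b Q identifies S_s(R) with e S_n(R) e. *)
Let P : 'M[R]_(n, s) := \matrix_(i, j) (i == g j)%:R.
Let Q : 'M[R]_(s, n) := \matrix_(j, i) (i == g j)%:R.

Let rotP : rot_mx P = P.
Proof.
apply/matrixP => i j; rewrite !mxE; congr (nat_of_bool _)%:R.
by rewrite g_rev (inj_eq rev_ord_inj).
Qed.

Let rotQ : rot_mx Q = Q.
Proof.
apply/matrixP => i j; rewrite !mxE; congr (nat_of_bool _)%:R.
by rewrite g_rev (inj_eq rev_ord_inj).
Qed.

Let QP : Q *m P = 1%:M.
Proof.
apply/matrixP => j l; rewrite !mxE (bigD1 (g j)) //= !mxE eqxx mul1r.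
rewrite (inj_eq g_inj) big1 ?addr0 // => i /negPf gi.
by rewrite !mxE gi mul0r.
Qed.

Fact centro_incl_subproof (b : centro_ring R s) :
  P *m val b *m Q \in centrosymmetric R n.
Proof. by apply/centro_rotP; rewrite !rot_mxM rotP rotQ rot_centro. Qed.

Fact centro_proj_subproof (a : centro_ring R n) :
  Q *m val a *m P \in centrosymmetric R s.
Proof. by apply/centro_rotP; rewrite !rot_mxM rotP rotQ rot_centro. Qed.

Let phi b : centro_ring R n := centro_of (centro_incl_subproof b).
Let psi a : centro_ring R s := centro_of (centro_proj_subproof a).

(** The pairs [X i], [Y i] factor the identity of size n through size s compatibly with J: a
    two-element orbit {i, i'} passes through {z, z'}, a fixed index through [c i]. An orbit is
    treated once, at its smaller member. *)
Let X (i : 'I_n) : 'M[R]_(n, s) :=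
  if (i < rev_ord i)%N then delta_mx i z + delta_mx (rev_ord i) (rev_ord z)
  else if rev_ord i == i then delta_mx i (c i) else 0.
Let Y (i : 'I_n) : 'M[R]_(s, n) :=
  if (i < rev_ord i)%N then delta_mx z i + delta_mx (rev_ord z) (rev_ord i)
  else if rev_ord i == i then delta_mx (c i) i else 0.

Let c_rev i : rev_ord i = i -> rev_ord (c i) = c i.
Proof. by move=> ri; apply: g_inj; rewrite g_rev g_fix. Qed.

Let rotX i : rot_mx (X i) = X i.
Proof.
rewrite /X; case: ifP => _.
  by rewrite rot_mxD !rot_delta_mx !rev_ordK addrC.
case: eqP => [ri|_]; first by rewrite rot_delta_mx ri c_rev.
by apply/matrixP => a b; rewrite !mxE.
Qed.

Let rotY i : rot_mx (Y i) = Y i.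
Proof.
rewrite /Y; case: ifP => _.
  by rewrite rot_mxD !rot_delta_mx !rev_ordK addrC.
case: eqP => [ri|_]; first by rewrite rot_delta_mx ri c_rev.
by apply/matrixP => a b; rewrite !mxE.
Qed.

Let XY1 : \sum_i X i *m Y i = 1%:M.
Proof.
have z_free' : rev_ord z != z by rewrite eq_sym.
(* An orbit contributes E_ii + E_i'i' at its smaller member; the cross terms vanish as z' differs
   from z. The second unit is written as a function of i', so that reindexing by reversal leaves
   each E_ii exactly once. *)
have XYE i : X i *m Y i =
    (if (i < rev_ord i)%N then delta_mx i i else 0) +
    (if (rev_ord (rev_ord i) < rev_ord i)%N
     then delta_mx (rev_ord i) (rev_ord i) else 0) +
    (if rev_ord i == i then delta_mx i i else 0).
  rewrite /X /Y rev_ordK; case: ifP => [lti|_].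
    have /negPf-> : rev_ord i != i by apply: contraTneq lti => ->; rewrite ltnn.
    rewrite mulmxDl !mulmxDr !mul_delta_mx !mul_delta_mx_0 //.
    by rewrite !addr0 add0r.
  by rewrite !add0r; case: eqP => _; rewrite ?mul_delta_mx ?mulmx0.
rewrite (eq_bigr _ (fun i _ => XYE i)) !big_split /=.
rewrite -(reindex_inj rev_ord_inj (P := xpredT) (F := fun i =>
  if (rev_ord i < i)%N then delta_mx i i else 0)).
rewrite -!big_split mx1_sum_delta; apply: eq_bigr => i _ /=.
by case: (ltngtP i (rev_ord i)) => [lti|lti|/val_inj <-];
  rewrite ?eqxx ?addr0 ?add0r //; have /negPf-> : rev_ord i != i;
  rewrite ?addr0 //; apply: contraTneq lti => ->; rewrite ltnn.
Qed.

Let X' i : X i *m Q \in centrosymmetric R n.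
Proof. by apply/centro_rotP; rewrite rot_mxM rotX rotQ. Qed.
Let Y' i : P *m Y i \in centrosymmetric R n.
Proof. by apply/centro_rotP; rewrite rot_mxM rotY rotP. Qed.

Lemma centro_corner_Morita :
  Morita_equivalent (centro_ring R n) (centro_ring R s).
Proof.
apply: (@corner_Morita _ _ phi psi n
  (fun i => centro_of (X' i)) (fun i => centro_of (Y' i))).
- by move=> b d; apply: val_inj; rewrite /= mulmxDr mulmxDl.
- move=> b d; apply: val_inj; rewrite /= -[RHS]/(_ *m _).
  by rewrite !mulmxA -(mulmxA _ Q) QP mulmx1.
- move=> b; apply: val_inj; rewrite /= !mulmxA QP mul1mx.
  by rewrite -mulmxA QP mulmx1.
- move=> a; apply: val_inj; rewrite /= -[RHS]/(_ *m _ *m _) mulmx1.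
  by rewrite !mulmxA.
(* Here e = P Q, so each summand X_i Q (P Q) P Y_i reduces to X_i Y_i by Q P = 1. *)
apply: val_inj; rewrite raddf_sum /= -[RHS]/(1%:M) -XY1.
apply: eq_bigr => i _; rewrite /= -[LHS]/(_ *m _ *m _) mulmx1 !mulmxA.
by rewrite -(mulmxA (X i)) QP mulmx1 -(mulmxA (X i)) QP mulmx1.
Qed.

End CentrosymmetricCorner.

Lemma centro_Morita2 (R : pzRingType) (n : nat) : (0 < n)%N -> ~~ odd n ->
  Morita_equivalent (centro_ring R n) (centro_ring R 2).
Proof.
case: n => // n _ oddn.
apply: (@centro_corner_Morita R n.+1 2
  (fun j => if j == ord0 then ord0 else ord_max) (fun=> ord0) ord0) => //.
- move=> i j /(congr1 val) gij; apply: val_inj; move: gij oddn.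
  by case: i j => [[|[|]]] //= ? [[|[|]]] //= ?; [move=> <- | move=> ->]. 
- by case=> [[|[]]] //= lti; apply: val_inj; rewrite /= ?subSS ?subn0 ?subnn.
(* A fixed index i would make the size 2i + 1, contradicting evenness. *)
- move=> i /(congr1 val) /= ri; have nE : n.+1 = (i + i).+1.
    by rewrite -[LHS](subnK (ltn_ord i)) ri addnS.
  by have := congr1 odd nE; rewrite (negPf oddn) /= oddD addbb.
Qed.

Lemma centro_Morita3 (R : pzRingType) (n : nat) : odd n -> (3 <= n)%N ->
  Morita_equivalent (centro_ring R n) (centro_ring R 3).
Proof.
case: n => // n /= oddn n3.
pose mid : 'I_n.+1 := inord n./2.
have nE : n = (n./2).*2 by rewrite -[LHS]odd_double_half (negbTE oddn).
have midE : mid = n./2 :> nat by rewrite inordK //; lia.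
have mid_rev : rev_ord mid = mid.
  by apply: val_inj; rewrite /= midE; lia.
pose g (j : 'I_3) := if val j == 0%N then ord0 else if val j == 1%N then mid
                     else ord_max.
apply: (@centro_corner_Morita R n.+1 3 g (fun=> inord 1) ord0) => //.
- move=> i j /(congr1 val) gij; apply: val_inj; move: gij nE n3.
  by case: i j => [[|[|[|]]]] //= ? [[|[|[|]]]] //= ?; rewrite /g /= ?midE;
    lia.
- case=> [[|[|[|]]]] //= lti; rewrite /g /= ?mid_rev //;
    by apply: val_inj; rewrite /= ?subSS ?subn0 ?subnn.
(* The middle index is the only fixed one, and [g] sends 1 to it. *)
- move=> i /(congr1 val) /= ri; rewrite /g /= inordK //=; apply: val_inj => /=.
  by rewrite midE -ri; lia.
Qed.

(** * Cellular algebras from a cell basis *)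

Section CellIdealOfBasis.
Variables (R : comPzRingType) (A : algebra R) (i : involution A) (J : ideal A).

Let sc (r : R) (x : A) : A := alg_str A r * x.

Lemma involution_sum (I : Type) (r : seq I) (P : pred I) (F : I -> A) :
  i (\sum_(j <- r | P j) F j) = \sum_(j <- r | P j) i (F j).
Proof. exact/morphD_sum/involutionD. Qed.

Lemma cell_tens_actD (D : leftIdeal A) a b :
  {morph @cell_tens_act R A i D a b : t u / t + u}.
Proof. exact/tens_liftD/cell_tens_act_balanced. Qed.

Lemma cell_tens_flipD (D : leftIdeal A) :
  {morph @cell_tens_flip R A i D : t u / t + u}.
Proof. exact/tens_liftD/cell_tens_flip_balanced. Qed.

(** Covers an empty index set, where there is no column to serve as the cell module; the zero ideal
    itself is taken as Delta, free of rank 0. *)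
Lemma cell_ideal0 : (forall x, x \in J -> x = 0) -> cell_ideal i J.
Proof.
move=> J0; split.
  move=> x; apply/asboolP/idP => [[y /J0-> ->]|/J0->].
    by rewrite involution0 rpred0.
  by exists 0; rewrite ?rpred0 ?involution0.
have J0' (x : sub_zmod J) : x = 0 by apply: val_inj; exact/J0/(valP x).
have T0 (t : cell_tens i J) : 0 = t.
  apply: (@tens_eqD _ _ _ _ _ _ (fun=> 0) id) => [u v||x y] //.
    by rewrite addr0.
  by rewrite [x]J0' (morphD_0 (tensDl _ _ y)).
exists J; split=> //.
  exists 0%N, (fun=> 0) => x; exists [ffun=> 0]; split.
    by rewrite big_ord0 [LHS]J0'.
  by move=> c _; apply/ffunP; case.
exists (fun=> 0); split=> [|x y|a b x|x y _].
- by exists (fun=> 0) => x; rewrite ?[x]J0'.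
- by rewrite addr0.
- by rewrite (morphD_0 (cell_tens_actD a b)).
- by rewrite (morphD_0 (@cell_tens_flipD J)).
Qed.

Variables (T : finType) (C : T -> T -> A) (co : T -> T -> A -> R).
Variable rho : A -> T -> T -> R.

Hypothesis spanJ : forall x, x \in J -> x = \sum_p \sum_q sc (co p q x) (C p q).
Hypothesis CJ : forall p q, C p q \in J.
Hypothesis co_span : forall (c : T -> T -> R) p q,
  co p q (\sum_r \sum_s sc (c r s) (C r s)) = c p q.
Hypothesis invC : forall p q, i (C p q) = C q p.
Hypothesis mulC : forall a p q, a * C p q = \sum_r sc (rho a r p) (C r q).

Let scD r s x : sc (r + s) x = sc r x + sc s x.
Proof. by rewrite /sc rmorphD mulrDl. Qed.
Let sc0 x : sc 0 x = 0. Proof. by rewrite /sc rmorph0 mul0r. Qed.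
Let sc1 x : sc 1 x = x. Proof. by rewrite /sc rmorph1 mul1r. Qed.
Let scA r s x : sc r (sc s x) = sc (r * s) x.
Proof. by rewrite /sc rmorphM mulrA. Qed.
Let sc_mull a r x : a * sc r x = sc r (a * x).
Proof. by rewrite /sc !mulrA alg_central. Qed.

(** Apply the involution to the left multiplication rule. *)
Let mulCr b p q : C p q * b = \sum_s sc (rho (i b) s q) (C p s).
Proof.
rewrite -{1}[b](involutionK i) -invC -involutionM mulC involution_sum.
by apply: eq_bigr => s _; rewrite involutionZ invC.
Qed.

Let sum_delta r p q : \sum_p' \sum_q'
  sc (if (p' == p) && (q' == q) then r else 0) (C p' q') = sc r (C p q).
Proof.
rewrite (bigD1 p) //= (bigD1 q) //= !eqxx /= !big1 ?addr0 //.
  by move=> p' /negPf np; rewrite big1 // => q' _; rewrite np sc0.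
by move=> q' /negPf nq; rewrite nq sc0.
Qed.

Let co_sc r p q p' q' :
  co p' q' (sc r (C p q)) = if (p' == p) && (q' == q) then r else 0.
Proof. by rewrite -sum_delta co_span. Qed.

(** The hypotheses determine [co] only on combinations of the [C p q], hence the restriction to
    [J]. *)
Let coD p q x y : x \in J -> y \in J -> co p q (x + y) = co p q x + co p q y.
Proof.
move=> /spanJ xE /spanJ yE; rewrite {1}xE {1}yE -big_split /=.
under eq_bigr => r _ do rewrite -big_split /=.
under eq_bigr => r _ do under eq_bigr => s _ do rewrite -scD.
by rewrite co_span.
Qed.

Fact span_inv_ideal x : x \in J -> i x \in J.
Proof.
move=> /spanJ->; rewrite involution_sum rpred_sum // => p _.
rewrite involution_sum rpred_sum // => q _.
by rewrite involutionZ invC idealMl.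
Qed.

Lemma span_stable : stable i J.
Proof.
move=> x; apply/asboolP/idP => [[y yJ ->]|xJ]; first exact: span_inv_ideal.
by exists (i x); rewrite ?involutionK ?span_inv_ideal.
Qed.

Let mk r p q : sub_zmod J :=
  Sub (sc r (C p q)) (idealMl (alg_str A r) (CJ p q)).

Let sub_eqD (G : zmodType) (f g : sub_zmod J -> G) :
    {morph f : x y / x + y} -> {morph g : x y / x + y} ->
  (forall r p q, f (mk r p q) = g (mk r p q)) -> f =1 g.
Proof.
move=> fD gD fg x.
have -> : x = \sum_p \sum_q mk (co p q (val x)) p q.
  apply: val_inj; rewrite [LHS]spanJ ?(valP x) // raddf_sum.
  by apply: eq_bigr => p _; rewrite raddf_sum.
rewrite (morphD_sum _ _ _ fD) (morphD_sum _ _ _ gD); apply: eq_bigr => p _.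
rewrite (morphD_sum _ _ _ fD) (morphD_sum _ _ _ gD); apply: eq_bigr => q _.
exact: fg.
Qed.

Section Base.
Variable t : T.

(** The cell module Delta, realised as the column of the basis at a base point t. Its image under
    the involution is the row at t. *)
Definition cell_col : {pred A} :=
  fun x => `[< exists c : T -> R, x = \sum_p sc (c p) (C p t) >].

Fact cell_col_zmod : zmod_closed cell_col.
Proof.
split=> [|_ _ /asboolP[c ->] /asboolP[d ->]]; apply/asboolP.
  by exists (fun=> 0); rewrite big1.
exists (fun p => c p - d p); rewrite -sumrB; apply: eq_bigr => p _.
by rewrite /sc rmorphB mulrBl.
Qed.

Fact cell_col_lmul (a x : A) : x \in cell_col -> a * x \in cell_col.
Proof.
move=> /asboolP[c ->]; apply/asboolP.
exists (fun r => \sum_p c p * rho a r p).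
rewrite mulr_sumr.
under eq_bigr => p _ do rewrite sc_mull mulC /sc mulr_sumr.
rewrite exchange_big; apply: eq_bigr => r _.
by rewrite /sc rmorph_sum mulr_suml; apply: eq_bigr => p _; exact: scA.
Qed.

HB.instance Definition _ := GRing.isZmodClosed.Build A cell_col cell_col_zmod.
HB.instance Definition _ := isLmulClosed.Build A cell_col cell_col_lmul.

Fact cell_col_gen p : C p t \in cell_col.
Proof.
apply/asboolP; exists (fun q => (q == p)%:R).
rewrite (bigD1 p) //= eqxx sc1 big1 ?addr0 // => q /negPf->.
by rewrite sc0.
Qed.

Let e p : sub_zmod cell_col := Sub (C p t) (cell_col_gen p).
Let f q : sub_zmod (inv_img i cell_col) := inv_to i (e q).
Let ls (r : R) (x : sub_zmod cell_col) := lact (alg_str A r) x.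
Let rs (y : sub_zmod (inv_img i cell_col)) (r : R) := ract y (alg_str A r).
Let ten (x : sub_zmod cell_col) (y : sub_zmod (inv_img i cell_col)) :
  cell_tens i cell_col := tens (fun x r => ls r x) (fun r y => rs y r) x y.

(** Pad the column by zeros to a full double sum, so that [co_span] applies. *)
Let col_co_sum (c : T -> R) p : co p t (\sum_r sc (c r) (C r t)) = c p.
Proof.
transitivity (co p t (\sum_r \sum_s sc (if s == t then c r else 0) (C r s))).
  congr (co _ _ _); apply: eq_bigr => r _.
  by rewrite (bigD1 t) //= eqxx big1 ?addr0 // => s /negPf->; rewrite sc0.
by rewrite co_span eqxx.
Qed.

Let col_span (x : sub_zmod cell_col) : x = \sum_p ls (co p t (val x)) (e p).
Proof.
apply: val_inj; rewrite raddf_sum /=; have /asboolP[c cE] := valP x.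
by rewrite cE; apply: eq_bigr => p _; rewrite col_co_sum.
Qed.

Lemma cell_col_free : finite_free cell_col.
Proof.
exists #|T|, (fun j => e (enum_val j)) => x.
have reind (c : T -> R) : \sum_p ls (c p) (e p) =
    \sum_(j < #|T|) ls (c (enum_val j)) (e (enum_val j)).
  rewrite (reindex (fun j : 'I_#|T| => enum_val j)) //.
  exact/onW_bij/enum_val_bij.
exists [ffun j => co (enum_val j) t (val x)]; split.
  rewrite {1}[x]col_span reind; apply: eq_bigr => j _.
  by rewrite ffunE.
move=> c xE; apply/ffunP => j; rewrite ffunE.
pose d p := c (enum_rank p).
have -> : x = \sum_p ls (d p) (e p).
  by rewrite reind [LHS]xE; apply: eq_bigr => l _; rewrite /d enum_valK.
by rewrite raddf_sum /= col_co_sum /d enum_valK.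
Qed.

Let row_span (y : sub_zmod (inv_img i cell_col)) :
  y = \sum_q rs (f q) (co t q (val y)).
Proof.
apply: val_inj; rewrite raddf_sum /=.
have /asboolP[_ /asboolP[c ->] ->] := valP y.
have rowE : i (\sum_p sc (c p) (C p t)) = \sum_p sc (c p) (C t p).
  rewrite involution_sum; apply: eq_bigr => p _.
  by rewrite involutionZ invC.
rewrite rowE; apply: eq_bigr => q _; rewrite invC -alg_central -/(sc _ _).
congr (sc _ _); transitivity (co t q
    (\sum_r \sum_s sc (if r == t then c s else 0) (C r s))).
  by rewrite co_span eqxx.
congr (co _ _ _); rewrite (bigD1 t) //= [X in _ + X]big1 ?addr0.
  by apply: eq_bigr => s _; rewrite eqxx.
by move=> r /negPf nr; rewrite big1 // => s _; rewrite nr sc0.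
Qed.

(** The bimodule isomorphism sending C p q to C p t (x) C t q, where C t q = i(C q t). *)
Let alpha (x : sub_zmod J) : cell_tens i cell_col :=
  \sum_p \sum_q ten (ls (co p q (val x)) (e p)) (f q).

Let lsD r s x : ls (r + s) x = ls r x + ls s x.
Proof. by apply: val_inj; exact: scD. Qed.

Let ls0 x : ls 0 x = 0.
Proof. by apply: val_inj; exact: sc0. Qed.

Let ten0l y : ten 0 y = 0. Proof. exact: (morphD_0 (tensDl _ _ y)). Qed.

Let alphaD : {morph alpha : x y / x + y}.
Proof.
move=> x y; rewrite /alpha -[RHS]big_split; apply: eq_bigr => p _.
rewrite -[RHS]big_split; apply: eq_bigr => q _.
by rewrite raddfD coD ?(valP x) ?(valP y) // lsD [LHS]tensDl.
Qed.

Let alpha_mk r p q : alpha (mk r p q) = ten (ls r (e p)) (f q).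
Proof.
rewrite /alpha (bigD1 p) //= (bigD1 q) //= co_sc !eqxx /=.
rewrite !big1 ?addr0 // => [p' /negPf np|q' /negPf nq].
  by rewrite big1 // => q' _; rewrite co_sc np ls0 ten0l.
by rewrite co_sc nq andbF ls0 ten0l.
Qed.

(** The inverse of [alpha] multiplies coordinates. The ring product would not do, since C p t * C t
    q need not be C p q. *)
Let beta0 (x : sub_zmod cell_col) (y : sub_zmod (inv_img i cell_col)) :
  sub_zmod J := \sum_p \sum_q mk (co p t (val x) * co t q (val y)) p q.

Let colJ (x : sub_zmod cell_col) : val x \in J.
Proof.
by have /asboolP[c ->] := valP x; apply: rpred_sum => p _; exact: idealMl.
Qed.

Let rowJ (y : sub_zmod (inv_img i cell_col)) : val y \in J.
Proof.
have /asboolP[x xC ->] := valP y.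
exact: span_inv_ideal (colJ (Sub x xC)).
Qed.

Let mkD r s p q : mk (r + s) p q = mk r p q + mk s p q.
Proof. by apply: val_inj; exact: scD. Qed.

Let coZ r p q x : x \in J -> co p q (sc r x) = r * co p q x.
Proof.
move=> /spanJ xE; rewrite {1}xE /sc mulr_sumr.
under eq_bigr => p' _ do rewrite mulr_sumr.
under eq_bigr => p' _ do
  under eq_bigr => q' _ do rewrite -/(sc _ _) -/(sc r _) scA.
by rewrite co_span.
Qed.

Let beta0_balanced : balanced (fun x r => ls r x) (fun r y => rs y r) beta0.
Proof.
split=> [y x x'|x y y'|x r y].
- rewrite /beta0 -big_split; apply: eq_bigr => p _ /=.
  rewrite -big_split; apply: eq_bigr => q _ /=.
  by rewrite coD ?colJ // mulrDl mkD.
- rewrite /beta0 -big_split; apply: eq_bigr => p _ /=.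
  rewrite -big_split; apply: eq_bigr => q _ /=.
  by rewrite coD ?rowJ // mulrDr mkD.
- apply: eq_bigr => p _; apply: eq_bigr => q _ /=; congr (mk _ _ _).
  rewrite -alg_central -!/(sc _ _) !coZ ?colJ ?rowJ //.
  by rewrite mulrCA mulrA.
Qed.

Let beta : cell_tens i cell_col -> sub_zmod J := tens_lift beta0.

Let betaD : {morph beta : t u / t + u}.
Proof. exact: tens_liftD beta0_balanced. Qed.

Let betaE x y : beta (ten x y) = beta0 x y.
Proof. exact: tens_lift_tens beta0_balanced _ _. Qed.

Let ten_suml (F : T -> sub_zmod cell_col) y :
  ten (\sum_p F p) y = \sum_p ten (F p) y.
Proof. exact: tens_suml. Qed.

Let ten_sumr (F : T -> sub_zmod (inv_img i cell_col)) x :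
  ten x (\sum_p F p) = \sum_p ten x (F p).
Proof. exact: tens_sumr. Qed.

Let ten_act x r y : ten (ls r x) y = ten x (rs y r).
Proof. exact: tens_act. Qed.

Let lsA r s x : ls r (ls s x) = ls (s * r) x.
Proof. by apply: val_inj; rewrite /= -/(sc _ _) -/(sc r _) scA mulrC. Qed.

Let alphaK : cancel alpha beta.
Proof.
apply: (sub_eqD (f := beta \o alpha) (g := id)) => // [x y|r p q] /=.
  by rewrite alphaD betaD.
rewrite alpha_mk betaE; apply: val_inj.
rewrite raddf_sum -[RHS]/(sc r (C p q)) -sum_delta.
apply: eq_bigr => p' _; rewrite raddf_sum; apply: eq_bigr => q' _ /=.
rewrite co_sc -{1}[C q t]sc1 involutionZ invC co_sc !eqxx andbT /=.
by congr (sc _ _); case: (p' == p); case: (q' == q);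
  rewrite ?mulr1 ?mulr0 ?mul0r.
Qed.

Let betaK : cancel beta alpha.
Proof.
apply: (tens_eqD (f := alpha \o beta) (g := id)) => // [x y|x y] /=.
  by rewrite betaD alphaD.
rewrite -[X in beta X]/(ten x y) betaE -[RHS]/(ten x y).
rewrite [in RHS](col_span x) [in RHS](row_span y) ten_suml /beta0.
rewrite (morphD_sum _ _ _ alphaD); apply: eq_bigr => p _.
rewrite (morphD_sum _ _ _ alphaD) ten_sumr; apply: eq_bigr => q _.
by rewrite alpha_mk -ten_act lsA.
Qed.

Let alpha_act a b x :
  alpha (lact a (ract x b)) = cell_tens_act a b (alpha x).
Proof.
apply: (sub_eqD (f := fun x => alpha (lact a (ract x b)))
  (g := fun x => cell_tens_act a b (alpha x))) => [y z|y z|r p q].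
- rewrite -alphaD; congr alpha; apply: val_inj.
  by rewrite /= mulrDl mulrDr.
- by rewrite alphaD cell_tens_actD.
rewrite alpha_mk /cell_tens_act.
rewrite [RHS](tens_lift_tens (@cell_tens_act_balanced R A i cell_col a b)).
rewrite -[RHS]/(ten (lact a (ls r (e p))) (ract (f q) b)).
(* On a generator r C p q both sides become the sum over u, v of r rho(a,u,p) rho(i b,v,q) C u t (x)
   C t v: [a] acts on the first index only, [b] on the second only. *)
have -> : lact a (ls r (e p)) = \sum_u ls (r * rho a u p) (e u).
  apply: val_inj; rewrite raddf_sum /= -/(sc r _) sc_mull mulC /sc mulr_sumr.
  by apply: eq_bigr => u _; exact: scA.
have -> : ract (f q) b = \sum_v rs (f v) (rho (i b) v q).
  apply: val_inj; rewrite raddf_sum /= invC mulCr.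
  by apply: eq_bigr => v _; rewrite /= invC; exact: alg_central.
rewrite ten_suml.
under eq_bigr => u _.
  rewrite ten_sumr.
  under eq_bigr => v _ do rewrite -ten_act lsA -alpha_mk.
  rewrite -(morphD_sum _ _ _ alphaD).
  over.
rewrite -(morphD_sum _ _ _ alphaD); congr alpha; apply: val_inj.
rewrite raddf_sum -[LHS]/(a * (alg_str A r * C p q * b)) -mulrA mulCr.
rewrite -/(sc r _) sc_mull mulr_sumr.
under eq_bigr => v _ do rewrite sc_mull mulC.
rewrite /sc mulr_sumr.
under eq_bigr => v _ do rewrite !mulr_sumr.
rewrite exchange_big; apply: eq_bigr => u _.
rewrite raddf_sum; apply: eq_bigr => v _.
rewrite -[RHS]/(sc _ _) -!/(sc _ _) !scA; congr (sc _ _).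
by rewrite -!mulrA; congr (_ * _); exact: mulrC.
Qed.

Let alpha_flip (x y : sub_zmod J) :
  val y = i (val x) -> alpha y = cell_tens_flip (alpha x).
Proof.
pose iJ (z : sub_zmod J) : sub_zmod J :=
  Sub (i (val z)) (span_inv_ideal (valP z)).
move=> yE; have -> : y = iJ x by apply: val_inj.
apply: (sub_eqD (f := alpha \o iJ)
  (g := @cell_tens_flip R A i cell_col \o alpha))
  => [u v|u v|r p q] /=.
- rewrite -alphaD; congr alpha; apply: val_inj; exact: involutionD.
- by rewrite alphaD cell_tens_flipD.
have -> : iJ (mk r p q) = mk r q p.
  by apply: val_inj; rewrite /= involutionZ invC.
rewrite !alpha_mk.
rewrite [RHS](tens_lift_tens (@cell_tens_flip_balanced R A i cell_col)).
rewrite -[RHS]/(ten _ _) ten_act; congr ten.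
  by apply: val_inj; rewrite /= involutionK.
by apply: val_inj; rewrite /= involutionZ alg_central.
Qed.

Lemma cell_ideal_of_pointed_basis : cell_ideal i J.
Proof.
split; first exact: span_stable.
exists (cell_col : leftIdeal A); split=> [x xC||].
- exact: colJ (Sub x xC).
- exact: cell_col_free.
- by exists alpha; split=> //; exists beta.
Qed.

End Base.

Lemma cell_ideal_of_basis : cell_ideal i J.
Proof.
case: (pickP (@predT T)) => [t _|T0]; first
  exact: cell_ideal_of_pointed_basis t.
apply: cell_ideal0 => x /spanJ->; rewrite big1 // => p.
by have := T0 p.
Qed.

End CellIdealOfBasis.

(* The cell datum of Graham and Lehrer, dualized: [co l p q] are the coordinate
   functions of the cell basis [C l p q]. *)
Section CellularOfBasis.
Variables (R : comPzRingType) (A : algebra R) (i : involution A) (k : nat).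
Variables (T : 'I_k -> finType) (C : forall l, T l -> T l -> A).
Variables (co : forall l, T l -> T l -> A -> R).
Variables (rho : forall l, A -> T l -> T l -> R).
Arguments C [l].
Arguments co [l].
Arguments rho [l].

Let sc (r : R) (x : A) : A := alg_str A r * x.

Definition layer_sum l (c : T l -> T l -> R) : A :=
  \sum_p \sum_q sc (c p q) (C p q).

Hypothesis coD : forall l (p q : T l), {morph co p q : x y / x + y}.
Hypothesis coZ : forall l (p q : T l) r x, co p q (sc r x) = r * co p q x.
Hypothesis coC : forall l (p q r s : T l),
  co p q (C r s) = ((p == r) && (q == s))%:R.
Hypothesis coC_neq : forall l m (p q : T l) (r s : T m),
  l != m -> co p q (C r s) = 0.
Hypothesis spanA : forall x, x = \sum_l layer_sum (fun p q : T l => co p q x).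
Hypothesis invC : forall l (p q : T l), i (C p q) = C q p.
Hypothesis mulC : forall l a (p q r s : T l),
  co r s (a * C p q) = if s == q then rho a r p else 0.
Hypothesis mulC_lt : forall l m a (p q : T l) (r s : T m),
  (l < m)%N -> co r s (a * C p q) = 0.

Let co0 l (p q : T l) : co p q 0 = 0. Proof. exact: morphD_0. Qed.

Let coB l (p q : T l) x y : co p q (x - y) = co p q x - co p q y.
Proof.
by apply: (@addIr _ (co p q y)); rewrite -coD !subrK.
Qed.

Let co_layer l (c : T l -> T l -> R) p q : co p q (layer_sum c) = c p q.
Proof.
rewrite /layer_sum (morphD_sum _ _ _ (@coD l p q)) (bigD1 p) //=.
rewrite (morphD_sum _ _ _ (@coD l p q)) (bigD1 q) //=.
rewrite coZ coC !eqxx mulr1 !big1 ?addr0 // => [r /negPf np|s /negPf nq].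
  rewrite (morphD_sum _ _ _ (@coD l p q)) big1 // => s _.
  by rewrite coZ coC eq_sym np mulr0.
by rewrite coZ coC (eq_sym q) nq andbF mulr0.
Qed.

Let co_layer_neq l m (c : T m -> T m -> R) (p q : T l) :
  l != m -> co p q (layer_sum c) = 0.
Proof.
move=> lm; rewrite (morphD_sum _ _ _ (@coD l p q)) big1 // => r _.
rewrite (morphD_sum _ _ _ (@coD l p q)) big1 // => s _.
by rewrite coZ coC_neq // mulr0.
Qed.

Let co_inv l (p q : T l) x : co p q (i x) = co q p x.
Proof.
rewrite {1}[x]spanA (morphD_sum _ _ _ (involutionD i)).
rewrite (morphD_sum _ _ _ (@coD l p q)).
have invE m : i (layer_sum (fun p q : T m => co p q x)) =
    layer_sum (fun p q : T m => co q p x).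
  rewrite /layer_sum exchange_big (morphD_sum _ _ _ (involutionD i)).
  apply: eq_bigr => r _; rewrite (morphD_sum _ _ _ (involutionD i)).
  by apply: eq_bigr => s _; rewrite involutionZ invC.
rewrite (bigD1 l) //= invE co_layer big1 ?addr0 // => m ml.
by rewrite invE co_layer_neq // eq_sym.
Qed.

Definition cell_layer l : {pred A} := fun x =>
  `[< forall m (p q : T m), m != l -> co p q x = 0 >].

(** The span of the layers below m, described dually by vanishing coordinates; from m = k on it is
    all of A. *)
Definition cell_ideals (m : nat) : {pred A} := fun x =>
  `[< forall l (p q : T l), (m <= l)%N -> co p q x = 0 >].

Fact cell_ideals_zmod m : zmod_closed (cell_ideals m).
Proof.
split=> [|x y /asboolP hx /asboolP hy]; apply/asboolP => l p q ml.
  exact: co0.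
by rewrite coB hx ?hy ?subrr.
Qed.

(** Expand x in the basis: layers from m on have zero coefficients, and by [mulC_lt] a product with
    a layer below m has no coordinate in a layer from m on. *)
Fact cell_ideals_lmul m (a x : A) :
  x \in cell_ideals m -> a * x \in cell_ideals m.
Proof.
move=> /asboolP hx; apply/asboolP => l p q ml.
rewrite [x]spanA mulr_sumr (morphD_sum _ _ _ (@coD l p q)) big1 // => j _.
rewrite mulr_sumr (morphD_sum _ _ _ (@coD l p q)) big1 // => r _.
rewrite mulr_sumr (morphD_sum _ _ _ (@coD l p q)) big1 // => s _.
rewrite /sc mulrA -alg_central -mulrA -/(sc _ _) coZ.
case: (leqP m j) => [mj|jm]; first by rewrite hx // mul0r.
by rewrite mulC_lt ?mulr0 // (leq_trans jm).
Qed.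

Fact cell_ideals_inv m (x : A) : x \in cell_ideals m -> i x \in cell_ideals m.
Proof.
by move=> /asboolP hx; apply/asboolP => l p q ml; rewrite co_inv hx.
Qed.

Fact cell_ideals_rmul m (a x : A) :
  x \in cell_ideals m -> x * a \in cell_ideals m.
Proof.
move=> hx; rewrite -[x * a](involutionK i) involutionM.
exact/cell_ideals_inv/cell_ideals_lmul/cell_ideals_inv.
Qed.

HB.instance Definition _ m :=
  GRing.isZmodClosed.Build A (cell_ideals m) (cell_ideals_zmod m).
HB.instance Definition _ m :=
  isLmulClosed.Build A (cell_ideals m) (@cell_ideals_lmul m).
HB.instance Definition _ m :=
  isRmulClosed.Build A (cell_ideals m) (@cell_ideals_rmul m).

Let stable_of (S : {pred A}) : (forall x, x \in S -> i x \in S) -> stable i S.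
Proof.
move=> iS x; apply/asboolP/idP => [[y yS ->]|xS]; first exact: iS.
by exists (i x); rewrite ?involutionK ?iS.
Qed.

Fact cell_ideals_stable m : stable i (cell_ideals m).
Proof. exact/stable_of/cell_ideals_inv. Qed.

Let layer_mem l (c : T l -> T l -> R) : layer_sum c \in cell_layer l.
Proof. by apply/asboolP => m p q; apply: co_layer_neq. Qed.

Let layer_span l x : x \in cell_layer l ->
  x = layer_sum (fun p q : T l => co p q x).
Proof.
move=> /asboolP hx; rewrite {1}[x]spanA (bigD1 l) //= big1 ?addr0 // => m ml.
rewrite /layer_sum big1 // => p _; rewrite big1 // => q _.
by rewrite hx // /sc rmorph0 mul0r.
Qed.

Let co_sum_layers (P : pred 'I_k) (y : 'I_k -> A) l (p q : T l) :
  (forall m, y m \in cell_layer m) ->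
  co p q (\sum_(m | P m) y m) = if P l then co p q (y l) else 0.
Proof.
move=> yP; rewrite (morphD_sum _ _ _ (@coD l p q)).
rewrite (big_mkcond P) (bigD1 l) //= big1 ?addr0 // => m ml.
by have /asboolP -> := yP m; rewrite ?if_same // eq_sym.
Qed.

Section Layer.
Variable l : 'I_k.

Let Q := quot_alg (cell_ideals l : ideal A).
Let pi : A -> Q := quot_pi (cell_ideals l).
(** Independent of the representative, because coordinates of layer l vanish on [cell_ideals l]. *)
Let qco (p q : T l) (u : Q) : R := co p q (quot_repr u).

Let qco_pi p q x : qco p q (pi x) = co p q x.
Proof.
apply/eqP; rewrite -subr_eq0 -coB; apply/eqP.
have : quot_repr (pi x) - x \in cell_ideals l.
  by apply/quot_piP; rewrite quot_reprK.
by move=> /asboolP; apply.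
Qed.

Let pi_layer (c : T l -> T l -> R) :
  pi (layer_sum c) = \sum_p \sum_q alg_str Q (c p q) * pi (C p q).
Proof.
rewrite /pi raddf_sum; apply: eq_bigr => p _; rewrite raddf_sum.
by apply: eq_bigr => q _; exact: (rmorphM (quot_pi (cell_ideals l))).
Qed.

Lemma cell_ideal_layer : cell_ideal (quot_inv (cell_ideals_stable l))
  (quot_ideal (cell_ideals l) (cell_ideals l.+1)).
Proof.
apply: (@cell_ideal_of_basis R Q _ _ (T l) (fun p q => pi (C p q)) qco
  (fun u => rho (quot_repr u))).
- move=> _ /asboolP[x /asboolP xI ->]; rewrite -/(pi x).
  under eq_bigr => p _ do under eq_bigr => q _ do rewrite qco_pi.
  (* Congruence modulo [cell_ideals l] is tested on layers m >= l: for m = l the coordinates agree,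
     for m > l both vanish. *)
  rewrite -pi_layer; apply/quot_piP/asboolP => m p q; rewrite leq_eqVlt.
  case/predU1P => [/val_inj lm|lm]; rewrite coB.
    by move: p q; rewrite -lm => p q; rewrite co_layer subrr.
  by rewrite xI // co_layer_neq ?subr0 // neq_ltn lm orbT.
- move=> p q; apply/asboolP; exists (C p q) => //; apply/asboolP => m r s lm.
  by rewrite coC_neq // neq_ltn lm orbT.
- by move=> c p q; rewrite -pi_layer qco_pi co_layer.
- by move=> p q; rewrite [LHS](quot_inv_pi (cell_ideals_stable l)) invC.
move=> u p q; rewrite -{1}[u]quot_reprK; set a := quot_repr u.
rewrite -[LHS](rmorphM (quot_pi (cell_ideals l))).
(* The product may have further components in lower layers, but these die in the quotient. *)
transitivity (pi (layer_sum (fun r s => if s == q then rho a r p else 0))).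
  apply/quot_piP/asboolP => m r s; rewrite leq_eqVlt coB.
  case/predU1P => [/val_inj lm|lm].
    by move: r s; rewrite -lm => r s; rewrite mulC co_layer subrr.
  by rewrite mulC_lt // co_layer_neq ?subr0 // neq_ltn lm orbT.
rewrite pi_layer; apply: eq_bigr => r _.
rewrite (bigD1 q) //= eqxx big1 ?addr0 // => s /negPf->.
by rewrite [X in X * _](rmorph0 (alg_str Q)) mul0r.
Qed.
End Layer.

Lemma cellular_of_basis : cellular_wrt i.
Proof.
exists k, cell_layer, (fun m => cell_ideals m : ideal A), cell_ideals_stable.
split=> [l|x|l|m x|l].
- split; first split=> [|x y /asboolP hx /asboolP hy].
  + by apply/asboolP => *; exact: co0.
  + by apply/asboolP => m p q ml; rewrite coB hx ?hy ?subrr.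
  + move=> r x /asboolP hx; apply/asboolP => m p q ml.
    by rewrite coZ hx // mulr0.
- exists [ffun l => layer_sum (fun p q : T l => co p q x)]; split.
    split=> [l|]; first by rewrite ffunE layer_mem.
    by rewrite {1}[x]spanA; apply: eq_bigr => l _; rewrite ffunE.
  move=> y [yP xE]; apply/ffunP => l; rewrite ffunE [RHS](layer_span (yP l)).
  apply: eq_bigr => p _; apply: eq_bigr => q _.
  by rewrite xE co_sum_layers.
- apply: stable_of => x /asboolP hx; apply/asboolP => m p q ml.
  by rewrite co_inv hx.
- split=> [/asboolP hx|[y [yP ->]]].
    exists (fun l => layer_sum (fun p q : T l => co p q x)); split=> //.
    rewrite {1}[x]spanA [RHS]big_mkcond; apply: eq_bigr => l _.
    case: ltnP => // ml; rewrite /layer_sum big1 // => p _.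
    by rewrite big1 // => q _; rewrite hx // /sc rmorph0 mul0r.
  apply/asboolP => l p q ml.
  by rewrite (co_sum_layers (fun l : 'I_k => (l < m)%N)) // ltnNge ml.
- exact: cell_ideal_layer.
Qed.

End CellularOfBasis.

(** * The cell basis of S_n(R) *)

Section CentrosymmetricCellular.
Variables (R : comPzRingType) (n : nat).
Let A : algebra R := centro_alg R n.
Implicit Types (a x : centro_ring R n) (l m : 'I_2).

Fact centro_tr_subproof x : (val x)^T \in centrosymmetric R n.
Proof.
apply/centrosymmetricP => p q; rewrite !mxE.
by have /centrosymmetricP<- := valP x.
Qed.

Definition centro_tr x : centro_ring R n := centro_of (centro_tr_subproof x).

Fact centro_trD : {morph centro_tr : x y / x + y}.
Proof. by move=> x y; apply: val_inj; rewrite /= linearD. Qed.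

Fact centro_trM (x y : centro_ring R n) :
  centro_tr (x * y) = centro_tr y * centro_tr x.
Proof. by apply: val_inj; exact: trmx_mul. Qed.

Fact centro_trZ (r : R) x :
  centro_tr (alg_str A r * x) = alg_str A r * centro_tr x.
Proof.
rewrite centro_trM [RHS](alg_central (a := A)); congr (_ * _).
by apply: val_inj; exact: tr_scalar_mx.
Qed.

Fact centro_trK : involutive centro_tr.
Proof. by move=> x; apply: val_inj; exact: trmxK. Qed.

Definition centro_involution : involution A :=
  @Involution R A centro_tr centro_trD centro_trZ centro_trM centro_trK.

Lemma val_centro_scale (r : R) x :
  val (alg_str A r * x : centro_ring R n) = r *: val x.
Proof. exact: mul_scalar_mx. Qed.

(* Representatives of the orbits of [rev_ord], without the fixed point when
   [l = 1]. *)
Definition orbit_rep l : finType := {p : 'I_n | (p + l <= rev_ord p)%N}.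

Definition sym_unit (p q : 'I_n) : 'M[R]_n := \matrix_(u, v)
  (((u == p) || (u == rev_ord p)) && ((v == q) || (v == rev_ord q)))%:R.

Definition rot_unit (p q : 'I_n) : 'M[R]_n := \matrix_(u, v)
  ((u == p) && (v == q) || (u == rev_ord p) && (v == rev_ord q))%:R.

Lemma rev_ord_eq (p q : 'I_n) : (rev_ord p == q) = (p == rev_ord q).
Proof. exact: can2_eq rev_ordK rev_ordK _ _. Qed.

Fact sym_unit_centro p q : sym_unit p q \in centrosymmetric R n.
Proof.
apply/centrosymmetricP => u v; rewrite !mxE !rev_ord_eq !rev_ordK.
by rewrite (orbC (u == p)) (orbC (v == q)).
Qed.

Fact rot_unit_centro p q : rot_unit p q \in centrosymmetric R n.
Proof.
by apply/centrosymmetricP => u v; rewrite !mxE !rev_ord_eq !rev_ordK orbC.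
Qed.

Definition centro_cell l (p q : orbit_rep l) : centro_ring R n :=
  if val l == 0%N then centro_of (sym_unit_centro (val p) (val q))
  else centro_of (rot_unit_centro (val p) (val q)).

(** For p, q in the first half, [sym_unit p q] has entry 1 at both (p, q) and (p, q'), while
    [rot_unit p q] has entry 1 at (p, q) and 0 at (p, q'). So the entry at (p, q') isolates the
    symmetric coefficient and the difference isolates the other. *)
Definition centro_coord l (p q : orbit_rep l) (x : centro_ring R n) : R :=
  if val l == 0%N then val x (val p) (rev_ord (val q))
  else val x (val p) (val q) - val x (val p) (rev_ord (val q)).

(** The matrix of [a] on the two cell modules: layer 0 is the action on the orbit indicators chi_p,
    with one term when p is fixed, and layer 1 the action on the vectors e_p - e_p'. *)
Definition centro_rho l (a : centro_ring R n) (r p : orbit_rep l) : R :=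
  let ap := val a (val r) (val p) in
  let ap' := val a (val r) (rev_ord (val p)) in
  if val l == 0%N then (if val p == rev_ord (val p) then ap else ap + ap')
  else ap - ap'.

Lemma mul_sym_unit (a : 'M[R]_n) p q u v : (a *m sym_unit p q) u v =
  (if p == rev_ord p then a u p else a u p + a u (rev_ord p)) *
  ((v == q) || (v == rev_ord q))%:R.
Proof.
rewrite mxE; under eq_bigr => w _ do rewrite mxE -mulnb natrM mulrA.
rewrite -mulr_suml; congr (_ * _); rewrite (bigD1 p) //= eqxx mulr1.
case: eqP => [<-|/eqP pp].
  by rewrite big1 ?addr0 // => w /negPf->; rewrite mulr0.
congr (_ + _); rewrite (bigD1 (rev_ord p)) 1?eq_sym //= eqxx orbT mulr1.
by rewrite big1 ?addr0 // => w /andP[/negPf-> /negPf->]; rewrite mulr0.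
Qed.

Lemma mul_rot_unit (a : 'M[R]_n) p q u v : p != rev_ord p ->
  (a *m rot_unit p q) u v =
  a u p * (v == q)%:R + a u (rev_ord p) * (v == rev_ord q)%:R.
Proof.
move=> pp; rewrite mxE (bigD1 p) //= mxE eqxx (negPf pp) orbF; congr (_ + _).
rewrite (bigD1 (rev_ord p)) /=; last by rewrite eq_sym.
rewrite mxE eqxx [rev_ord p == p]eq_sym (negPf pp) /=.
rewrite big1 ?addr0 // => w /andP[/negPf wp /negPf wp'].
by rewrite mxE wp wp' mulr0.
Qed.

Lemma val_layer_sum l (c : orbit_rep l -> orbit_rep l -> R) u v :
  val (layer_sum (A := A) (@centro_cell) c : centro_ring R n) u v =
  \sum_p \sum_q c p q * val (centro_cell p q) u v.
Proof.
rewrite /layer_sum raddf_sum summxE; apply: eq_bigr => p _.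
rewrite raddf_sum summxE; apply: eq_bigr => q _.
transitivity ((c p q *: val (centro_cell p q)) u v); last by rewrite mxE.
by rewrite -val_centro_scale.
Qed.

(** A given matrix entry meets a single pair of orbits, so each layer contributes at most one term
    to it. The guard fails in layer 1 when a representative is the fixed index. *)
Lemma sum_orbit_rep l (c d : 'I_n) (F : 'I_n -> 'I_n -> R) :
    (forall p q : orbit_rep l, (val p != c) || (val q != d) ->
       F (val p) (val q) = 0) ->
  \sum_(p : orbit_rep l) \sum_(q : orbit_rep l) F (val p) (val q) =
  if (c + l <= rev_ord c)%N && (d + l <= rev_ord d)%N then F c d else 0.
Proof.
move=> F0; case: ifP => [/andP[cl dl]|/negbT cdl].
  rewrite (bigD1 (exist _ c cl : orbit_rep l)) //=.
  rewrite (bigD1 (exist _ d dl : orbit_rep l)) //= !big1 ?addr0 //.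
    move=> p; rewrite -(inj_eq val_inj) => pc; rewrite big1 // => q _.
    by apply: (F0 p q); rewrite pc.
  move=> q; rewrite -(inj_eq val_inj) => qd.
  by apply: (F0 (exist _ c cl) q); rewrite qd orbT.
rewrite big1 // => p _; rewrite big1 // => q _; apply: (F0 p q).
apply: (contraNT _ cdl); rewrite negb_or !negbK => /andP[/eqP <- /eqP <-];
by rewrite (valP p) (valP q).
Qed.

Lemma centro_span x :
  x = \sum_l layer_sum (A := A) (@centro_cell)
        (fun p q : orbit_rep l => centro_coord p q x).
Proof.
have xE u v : val x u v = val x (rev_ord u) (rev_ord v).
  by have /centrosymmetricP := valP x.
apply: val_inj; apply/matrixP => u v.
rewrite big_ord_recl big_ord1 raddfD mxE !val_layer_sum.
pose rep (w : 'I_n) := if (w <= rev_ord w)%N then w else rev_ord w.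
rewrite (@sum_orbit_rep ord0 (rep u) (rep v)
  (fun p q => val x p (rev_ord q) * sym_unit p q u v)); last first.
  move=> p q pq; rewrite mxE (_ : _ && _ = false) ?mulr0 //.
  by move: (valP p) (valP q) pq; rewrite /rep; case: ifP; case: ifP;
    rewrite -!val_eqE /=; lia.
rewrite (@sum_orbit_rep (fintype.lift ord0 ord0) (rep u) (rep v)
  (fun p q => (val x p q - val x p (rev_ord q)) * rot_unit p q u v)); last first.
  move=> p q pq; rewrite mxE (_ : _ || _ = false) ?mulr0 //.
  by move: (valP p) (valP q) pq; rewrite /rep; case: ifP; case: ifP;
    rewrite -!val_eqE /=; lia.
have repP w : (rep w + ord0 <= rev_ord (rep w))%N.
  by rewrite /rep; case: ifP; rewrite /=; lia.
have repE w : (w == rep w) || (w == rev_ord (rep w)).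
  by rewrite /rep; case: ifP; rewrite ?rev_ordK eqxx ?orbT.
have l1E : fintype.lift ord0 (ord0 : 'I_1) = 1%N :> nat by [].
rewrite !mxE !repP !repE l1E mulr1 /rep.
have fixE w : nat_of_ord w = rev_ord w -> rev_ord w = w.
  by move=> ww; apply: val_inj.
have [un vn] := (ltn_ord u, ltn_ord v).
(* Split by the halves containing u and v. In the same half both units have entry 1 and the
   coefficients telescope, x_pq' + (x_pq - x_pq'); in opposite halves only the symmetric unit
   contributes. *)
case: ifP => [hu|/negbT hu]; case: ifP => [hv|/negbT hv]; rewrite ?rev_ordK;
  rewrite -!val_eqE /= in hu hv *.
- case: ifP => [_|/negbT huv]; first by rewrite !eqxx /= mulr1 addrC subrK.
  (* Layer 1 is absent when u or v is fixed; then the entries of x at (u, v) and (u, v')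
     coincide. *)
  rewrite addr0; have [/fixE ru|/fixE rv] : u = rev_ord u :> nat \/
      v = rev_ord v :> nat by rewrite /=; lia.
    by rewrite xE ru.
  by rewrite rv.
- case: ifP => [huv|_]; last by rewrite addr0.
  by rewrite (_ : _ || _ = false) ?mulr0 ?addr0 //; lia.
- case: ifP => [huv|_]; last by rewrite addr0 xE.
  by rewrite (_ : _ || _ = false) ?mulr0 ?addr0 //; lia.
case: ifP => [_|/negbT huv]; last by lia.
rewrite (_ : _ || _ = true) ?mulr1; last by lia.
by rewrite addrC subrK; exact: xE.
Qed.

Lemma centro_cellular : cellular A.
Proof.
exists centro_involution.
apply: (@cellular_of_basis R A centro_involution 2 orbit_rep centro_cell
  centro_coord centro_rho).
- move=> l p q x y; rewrite /centro_coord; case: ifP => _; rewrite /= !mxE //.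
  by rewrite opprD addrACA.
- move=> l p q r x; rewrite /centro_coord; case: ifP => _;
    by rewrite val_centro_scale !mxE // mulrBr.
(* Representatives p and r satisfy p = r' only when p = r is the fixed index; this decides every
   comparison of indices. *)
- case=> [[|[|l]] // ltl] p q r s; move: (valP p) (valP q) (valP r) (valP s);
    rewrite /centro_coord /centro_cell -(inj_eq val_inj p) -(inj_eq val_inj q);
    rewrite /= !mxE -!val_eqE /= => hp hq hr hs.
    by congr (nat_of_bool _)%:R; lia.
  by rewrite -[RHS]subr0; congr (_ - _); [congr (nat_of_bool _)%:R
    | rewrite -[RHS]/(false%:R); congr (nat_of_bool _)%:R]; lia.
- case=> [[|[|l]] // ltl] [[|[|m]] // ltm] p q r s //= _;
    move: (valP p) (valP q) (valP r) (valP s);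
    rewrite /centro_coord /centro_cell /= !mxE -!val_eqE /= => hp hq hr hs.
    by rewrite -[RHS]/(false%:R); congr (nat_of_bool _)%:R; lia.
  by apply/eqP; rewrite subr_eq0; apply/eqP; congr (nat_of_bool _)%:R; lia.
- exact: centro_span.
- by case=> [[|[|l]] // ltl] p q; apply: val_inj; apply/matrixP => u v;
    rewrite !mxE andbC // (andbC (v == _)).
- case=> [[|[|l]] // ltl] a p q r s; move: (valP p) (valP q) (valP s);
    rewrite /centro_coord /centro_cell /centro_rho -(inj_eq val_inj s);
    move=> /= hp hq hs.
    rewrite mul_sym_unit (_ : _ || _ = (sval s == sval q)).
      by case: (sval s == sval q); rewrite ?mulr1 ?mulr0.
    by rewrite -!val_eqE /=; lia.
  have pp : sval p != rev_ord (sval p) by rewrite -val_eqE /=; lia.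
  rewrite !mul_rot_unit // !rev_ord_eq rev_ordK.
  have -> : (sval s == rev_ord (sval q)) = false by rewrite -val_eqE /=; lia.
  rewrite !mulr0 addr0 add0r -mulrBl.
  by case: (sval s == sval q); rewrite ?mulr1 ?mulr0.
(* Only l = 0, m = 1 remains: columns s and s' of a product with a symmetric unit are equal, so the
   difference coordinate is 0. *)
- case=> [[|[|l]] // ltl] [[|[|m]] // ltm] a p q r s //= _.
  apply/eqP; rewrite /centro_coord /centro_cell /= subr_eq0.
  by rewrite !mul_sym_unit !rev_ord_eq rev_ordK orbC.
Qed.

End CentrosymmetricCellular.

Theorem mainTheorem1 :
  (forall (R : pzRingType) (n : nat), (0 < n)%N ->
     [/\ separable_Frobenius_extension (centrosymmetric R n),
         ~~ odd n -> Morita_equivalent (centro_ring R n) (centro_ring R 2)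
       & odd n -> (3 <= n)%N ->
           Morita_equivalent (centro_ring R n) (centro_ring R 3)]) /\
  (forall (R : comPzRingType) (n : nat), (0 < n)%N ->
     cellular (centro_alg R n)).
Proof.
split=> R n n0; last exact: centro_cellular.
split; first exact: centro_separable_Frobenius.
  exact: centro_Morita2.
exact: centro_Morita3.
Qed.
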